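(* For every $n\ge 3$, the group $\mathrm{SL}_n(\mathbb Z)$ admits the finite $2$-generator presentation $$\mathrm{SL}_n(\mathbb Z)\cong\langle a,b\mid \mathcal R_n(a,b)\rangle,$$ where $\mathcal R_n(a,b)$ consists of the following relations: \begin{align*} &[\tau_{i,j}(a,b),\tau_{k,l}(a,b)]=1 && \text{for all } i\ne j,\ k\ne l \text{ with } (i,j)\ne(k,l),\ i\ne l,\ j\ne k,\\ &[\tau_{i,j}(a,b),\tau_{j,k}(a,b)]=\tau_{i,k}(a,b) && \text{for distinct } i,j,k,\\ &\bigl(\tau_{1,2}(a,b)\tau_{2,1}(a,b)^{-1}\tau_{1,2}(a,b)\bigr)^4=1,\\ &a=\bigl(\tau_{n-1,n}\tau_{n,n-1}^{-1}\tau_{n-1,n}\bigr)\bigl(\tau_{n-2,n-1}\tau_{n-1,n-2}^{-1}\tau_{n-2,n-1}\bigr)\cdots\bigl(\tau_{1,2}\tau_{2,1}^{-1}\tau_{1,2}\bigr), \end{align*} with all indices in $\{1,\dots,n\}$ and $\tau_{i,j}=\tau_{i,j}(a,b)$.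
   Context: Commutators are $[x,y]=x^{-1}y^{-1}xy$, and a relation $U=V$ means the relator $UV^{-1}$. $E_{i,j}$ denotes the standard $n\times n$ matrix unit. Put $\varepsilon_n=(-1)^{n-1}$ and $$a_n=\sum_{i=1}^{n-1}E_{i,i+1}+\varepsilon_nE_{n,1},\qquad b_n=I_n+E_{2,1};$$ the generators $a,b$ of the presentation correspond to the matrices $a_n,b_n\in\mathrm{SL}_n(\mathbb Z)$. The words $\tau_{ij}=\tau_{i,j}=\tau_{ij}(a,b)$ in the free group on $a,b$ ($1\le i\ne j\le n$) are defined as follows. Step 1: $\tau_{r+1,r}:=a^{-(r-1)}ba^{r-1}$ for $1\le r\le n-1$, and $\tau_{1n}:=\bigl(a^{-(n-1)}ba^{n-1}\bigr)^{\varepsilon_n}$. Step 2: for $d=2,\dots,n-1$ successively and all $i,j$ with $i-j=d$, $\tau_{ij}:=[\tau_{i,j+1},\tau_{j+1,j}]$. Step 3: for $2\le i\le n-1$, $\tau_{in}:=[\tau_{i1},\tau_{1n}]$. Step 4: for $1\le i<j\le n-1$, $\tau_{ij}:=[\tau_{in},\tau_{nj}]$. *)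

(* Defs.v *)
From HB Require Import structures.
From mathcomp Require Import all_boot all_order all_algebra.
From mathcomp Require Import boolp.

Set Implicit Arguments.
Unset Strict Implicit.
Unset Printing Implicit Defensive.

Import GRing.Theory.
Local Open Scope quotient_scope.

(* ------------------------------------------------------------------------- *)
(* Free groups: words in the letters x, x^-1 (encoded as (x, true) and       *)
(* (x, false)), modulo insertion and deletion of subwords x x^-1, x^-1 x.    *)

Section FreeGroup.
Variable X : choiceType.

Definition word := seq (X * bool).

Inductive word_eq : word -> word -> Prop :=
| word_eq_refl u : word_eq u u
| word_eq_sym u v : word_eq u v -> word_eq v u
| word_eq_trans v u w : word_eq u v -> word_eq v w -> word_eq u w
| word_eq_cancel u v x e : word_eq (u ++ [:: (x, e); (x, ~~ e)] ++ v) (u ++ v).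

Definition word_inv (u : word) : word := rev [seq (p.1, ~~ p.2) | p <- u].

Definition word_eqb : rel word := fun u v => `[< word_eq u v >].

Fact word_eqb_refl : reflexive word_eqb.
Proof. by move=> u; apply/asboolP; exact: word_eq_refl. Qed.

Fact word_eqb_sym : symmetric word_eqb.
Proof.
by move=> u v; apply/idP/idP => /asboolP uv; apply/asboolP; exact: word_eq_sym.
Qed.

Fact word_eqb_trans : transitive word_eqb.
Proof.
move=> v u w /asboolP uv /asboolP vw; apply/asboolP; exact: word_eq_trans vw.
Qed.

Canonical word_equiv :=
  EquivRel word_eqb word_eqb_refl word_eqb_sym word_eqb_trans.

Definition freeGroup := {eq_quot word_eqb}.

HB.instance Definition _ := Choice.on freeGroup.

Definition fg_class (u : word) : freeGroup := \pi_freeGroup u.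

Lemma fg_classP u v : reflect (word_eq u v) (fg_class u == fg_class v).
Proof. by rewrite /fg_class piE /=; exact: asboolP. Qed.

Lemma fg_classK : cancel repr fg_class.
Proof. exact: reprK. Qed.

Lemma word_eq_cat u u' v v' :
  word_eq u u' -> word_eq v v' -> word_eq (u ++ v) (u' ++ v').
Proof.
move=> uu' vv'; apply: (@word_eq_trans (u' ++ v)).
  elim: uu' => {u u'} [u|u w _ /word_eq_sym //|w u z _ uw _ wz|u w x e].
  - exact: word_eq_refl.
  - exact: word_eq_trans wz.
  - by rewrite -!catA; exact: word_eq_cancel.
elim: vv' => {v v'} [v|v w _ /word_eq_sym //|w v z _ vw _ wz|v w x e].
- exact: word_eq_refl.
- exact: word_eq_trans wz.
- by rewrite !(catA u'); exact: word_eq_cancel.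
Qed.

Lemma word_inv_cat u v : word_inv (u ++ v) = word_inv v ++ word_inv u.
Proof. by rewrite /word_inv map_cat rev_cat. Qed.

Lemma word_eq_inv u v : word_eq u v -> word_eq (word_inv u) (word_inv v).
Proof.
elim=> {u v} [u|u w _ /word_eq_sym //|w u z _ uw _ wz|u w x e].
- exact: word_eq_refl.
- exact: word_eq_trans wz.
- rewrite !word_inv_cat -catA /word_inv /= /rev /= -/(rev _) negbK.
  exact: word_eq_cancel.
Qed.

Lemma word_eq_mulV u : word_eq (u ++ word_inv u) [::].
Proof.
elim: u => [|[x e] u IHu]; first exact: word_eq_refl.
have -> : word_inv ((x, e) :: u) = word_inv u ++ [:: (x, ~~ e)].
  by rewrite -cat1s word_inv_cat.
apply: (@word_eq_trans ([:: (x, e)] ++ [::] ++ [:: (x, ~~ e)])).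
  rewrite -cat1s -catA; apply: word_eq_cat; first exact: word_eq_refl.
  by rewrite catA; apply: word_eq_cat => //; exact: word_eq_refl.
exact: (word_eq_cancel [::] [::]).
Qed.

Lemma word_invK : involutive word_inv.
Proof.
move=> u; rewrite /word_inv map_rev revK -map_comp map_id_in //.
by case=> x e _ /=; rewrite negbK.
Qed.

Definition fg_mul (x y : freeGroup) : freeGroup := fg_class (repr x ++ repr y).
Definition fg_inv (x : freeGroup) : freeGroup := fg_class (word_inv (repr x)).
Definition fg_one : freeGroup := fg_class [::].

Lemma word_eq_repr u : word_eq (repr (fg_class u)) u.
Proof. by apply/fg_classP; rewrite fg_classK. Qed.

Lemma fg_classM u v : fg_mul (fg_class u) (fg_class v) = fg_class (u ++ v).
Proof. by apply/eqP/fg_classP; apply: word_eq_cat; exact: word_eq_repr. Qed.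

Lemma fg_classV u : fg_inv (fg_class u) = fg_class (word_inv u).
Proof. by apply/eqP/fg_classP; apply: word_eq_inv; exact: word_eq_repr. Qed.

Fact fg_mulA : associative fg_mul.
Proof.
move=> u v w; rewrite -[u]fg_classK -[v]fg_classK -[w]fg_classK.
by rewrite (fg_classM (repr v) (repr w)) (fg_classM (repr u) (repr v))
  !fg_classM catA.
Qed.

Fact fg_mul1g : left_id fg_one fg_mul.
Proof. by move=> u; rewrite -[u]fg_classK fg_classM. Qed.

Fact fg_mulg1 : right_id fg_one fg_mul.
Proof. by move=> u; rewrite -[u]fg_classK fg_classM cats0. Qed.

Fact fg_mulgV : right_inverse fg_one fg_inv fg_mul.
Proof.
by move=> u; rewrite -[u]fg_classK fg_classV fg_classM;
  apply/eqP/fg_classP/word_eq_mulV.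
Qed.

Fact fg_mulVg : left_inverse fg_one fg_inv fg_mul.
Proof.
move=> u; rewrite -[u]fg_classK fg_classV fg_classM; apply/eqP/fg_classP.
by rewrite -{2}(word_invK (repr u)); exact: word_eq_mulV.
Qed.

HB.instance Definition _ := isGroup.Build freeGroup
  fg_mulA fg_mul1g fg_mulg1 fg_mulVg fg_mulgV.

Definition fgen (x : X) : freeGroup := fg_class [:: (x, true)].

End FreeGroup.

(* ------------------------------------------------------------------------- *)
(* Quotient of a group G by the normal closure of a finite list R of         *)
(* elements. When G is the free group on X, this is the group < X | R >.     *)

Section Quotient.
Variables (G : groupType) (R : seq G).
Local Open Scope group_scope.

Inductive normal_closure : G -> Prop :=
| normal_closure_rel r : r \in R -> normal_closure r
| normal_closure1 : normal_closure 1
| normal_closureM x y :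
    normal_closure x -> normal_closure y -> normal_closure (x * y)
| normal_closureV x : normal_closure x -> normal_closure x^-1
| normal_closureJ x y : normal_closure x -> normal_closure (x ^ y).

Definition nc_eqb : rel G := fun x y => `[< normal_closure (x^-1 * y) >].

Fact nc_eqb_refl : reflexive nc_eqb.
Proof. by move=> x; apply/asboolP; rewrite mulVg; exact: normal_closure1. Qed.

Fact nc_eqb_sym : symmetric nc_eqb.
Proof.
by move=> x y; apply/idP/idP => /asboolP/normal_closureV;
  rewrite invgM invgK => xy; apply/asboolP.
Qed.

Fact nc_eqb_trans : transitive nc_eqb.
Proof.
move=> y x z /asboolP xy /asboolP yz; apply/asboolP.
by have := normal_closureM xy yz; rewrite mulgA mulgK.
Qed.

Canonical nc_equiv := EquivRel nc_eqb nc_eqb_refl nc_eqb_sym nc_eqb_trans.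

Definition presented := {eq_quot nc_eqb}.

HB.instance Definition _ := Choice.on presented.

Definition pr_class (x : G) : presented := \pi_presented x.

Lemma pr_classP x y :
  reflect (normal_closure (x^-1 * y)) (pr_class x == pr_class y).
Proof. by rewrite /pr_class piE /=; exact: asboolP. Qed.

Lemma pr_classK : cancel repr pr_class.
Proof. exact: reprK. Qed.

Definition pr_mul (x y : presented) : presented := pr_class (repr x * repr y).
Definition pr_inv (x : presented) : presented := pr_class (repr x)^-1.
Definition pr_one : presented := pr_class (1 : G).

Lemma nc_repr x : normal_closure ((repr (pr_class x))^-1 * x).
Proof. by apply/pr_classP; rewrite pr_classK. Qed.

Lemma pr_classM x y : pr_mul (pr_class x) (pr_class y) = pr_class (x * y).
Proof.
apply/eqP/pr_classP.
set x' := repr _; set y' := repr _.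
have -> : (x' * y')^-1 * (x * y) = (x'^-1 * x) ^ y' * (y'^-1 * y).
  by rewrite /conjg invgM !mulgA mulgK.
by apply: normal_closureM; first apply: normal_closureJ; exact: nc_repr.
Qed.

Lemma pr_classV x : pr_inv (pr_class x) = pr_class x^-1.
Proof.
apply/eqP/pr_classP.
set x' := repr _.
have -> : (x'^-1)^-1 * x^-1 = ((x'^-1 * x)^-1) ^ x'^-1.
  by rewrite /conjg invgM !invgK !mulgA mulgK.
by apply/normal_closureJ/normal_closureV/nc_repr.
Qed.

Fact pr_mulA : associative pr_mul.
Proof.
move=> x y z; rewrite -[x]pr_classK -[y]pr_classK -[z]pr_classK.
by rewrite (pr_classM (repr y) (repr z)) (pr_classM (repr x) (repr y))
  !pr_classM mulgA.
Qed.

Fact pr_mul1g : left_id pr_one pr_mul.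
Proof. by move=> x; rewrite -[x]pr_classK pr_classM mul1g. Qed.

Fact pr_mulg1 : right_id pr_one pr_mul.
Proof. by move=> x; rewrite -[x]pr_classK pr_classM mulg1. Qed.

Fact pr_mulVg : left_inverse pr_one pr_inv pr_mul.
Proof. by move=> x; rewrite -[x]pr_classK pr_classV pr_classM mulVg. Qed.

Fact pr_mulgV : right_inverse pr_one pr_inv pr_mul.
Proof. by move=> x; rewrite -[x]pr_classK pr_classV pr_classM mulgV. Qed.

HB.instance Definition _ := isGroup.Build presented
  pr_mulA pr_mul1g pr_mulg1 pr_mulVg pr_mulgV.

End Quotient.

(* ------------------------------------------------------------------------- *)

Section SpecialLinear.
Variables (R : comUnitRingType) (n : nat).
Local Open Scope ring_scope.

Record specialLinear := SpecialLinear {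
  slval :> 'M[R]_n;
  _ : \det slval == 1
}.

HB.instance Definition _ := [isSub for slval].
HB.instance Definition _ := [Choice of specialLinear by <:].

Lemma det_slval (A : specialLinear) : \det A = 1.
Proof. exact/eqP/(valP A). Qed.

Lemma slval_unit (A : specialLinear) : slval A \in unitmx.
Proof. by rewrite unitmxE det_slval unitr1. Qed.

Fact sl_mul_subproof (A B : specialLinear) : \det (A *m B) == 1.
Proof. by rewrite det_mulmx !det_slval mulr1. Qed.

Fact sl_inv_subproof (A : specialLinear) : \det (invmx A) == 1.
Proof. by rewrite det_inv det_slval invr1. Qed.

Fact sl_one_subproof : \det (1%:M : 'M[R]_n) == 1.
Proof. by rewrite det1. Qed.

Definition sl_mul A B := SpecialLinear (sl_mul_subproof A B).
Definition sl_inv A := SpecialLinear (sl_inv_subproof A).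
Definition sl_one := SpecialLinear sl_one_subproof.

Fact sl_mulA : associative sl_mul.
Proof. by move=> A B C; apply: val_inj; exact: mulmxA. Qed.

Fact sl_mul1g : left_id sl_one sl_mul.
Proof. by move=> A; apply: val_inj; exact: mul1mx. Qed.

Fact sl_mulg1 : right_id sl_one sl_mul.
Proof. by move=> A; apply: val_inj; exact: mulmx1. Qed.

Fact sl_mulVg : left_inverse sl_one sl_inv sl_mul.
Proof. by move=> A; apply: val_inj; exact/mulVmx/slval_unit. Qed.

Fact sl_mulgV : right_inverse sl_one sl_inv sl_mul.
Proof. by move=> A; apply: val_inj; exact/mulmxV/slval_unit. Qed.

HB.instance Definition _ := isGroup.Build specialLinear
  sl_mulA sl_mul1g sl_mulg1 sl_mulVg sl_mulgV.

End SpecialLinear.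

(* ------------------------------------------------------------------------- *)
(* All matrix and word indices below are natural numbers in {1, ..., n}.     *)

Section Matrices.
Variable n : nat.
Local Open Scope ring_scope.

Definition Emx (i j : nat) : 'M[int]_n :=
  \matrix_(k < n, l < n) ((k.+1 == i) && (l.+1 == j))%:R.

Definition eps : int := (-1) ^+ n.-1.

Definition a_mx : 'M[int]_n :=
  (\sum_(1 <= i < n) Emx i i.+1) + eps *: Emx n 1.

Definition b_mx : 'M[int]_n := 1%:M + Emx 2 1.

End Matrices.

Section Words.
Variables (G : groupType) (n : nat) (a b : G).
Local Open Scope group_scope.

(* x ^ (eps n), as eps n is 1 or -1. *)
Definition expg_eps (x : G) : G := if eps n == 1%R then x else x^-1.

Definition conj_pow (k : nat) : G := a ^- k * b * a ^+ k.

(* tau_low d j is tau_(j + d, j), defined by recursion on d = i - j as       *)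
(* [tau_(i, j + 1), tau_(j + 1, j)]; the value at d = 0 is junk.             *)
Fixpoint tau_low (d j : nat) : G :=
  match d with
  | 0 => 1
  | 1 => conj_pow j.-1
  | d'.+1 => [~ tau_low d' j.+1, conj_pow j.-1]
  end.

Definition tau_1n : G := expg_eps (conj_pow n.-1).

(* tau_col i is tau_(i, n) for 1 <= i <= n - 1. *)
Definition tau_col (i : nat) : G :=
  if i == 1%N then tau_1n else [~ tau_low i.-1 1, tau_1n].

(* The value on the diagonal i = j is junk. *)
Definition tau (i j : nat) : G :=
  if i == j then 1
  else if (j < i)%N then tau_low (i - j) j
  else if j == n then tau_col i
  else [~ tau_col i, tau_low (n - j) j].

Definition weyl (i j : nat) : G := tau i j * (tau j i)^-1 * tau i j.

Definition indices : seq nat := index_iota 1 n.+1.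

Definition offdiag : seq (nat * nat) :=
  [seq p <- [seq (i, j) | i <- indices, j <- indices] | p.1 != p.2].

Definition relators_comm : seq G :=
  [seq [~ tau p.1 p.2, tau q.1 q.2] | p <- offdiag,
     q <- [seq q <- offdiag | [&& p != q, p.1 != q.2 & p.2 != q.1]]].

Definition relators_steinberg : seq G :=
  [seq [~ tau p.1 p.2, tau p.2 k] / tau p.1 k | p <- offdiag,
     k <- [seq k <- indices | (k != p.1) && (k != p.2)]].

(* The last relator uses the product of weyl r r.+1 for r = n - 1, ..., 1,   *)
(* in that (decreasing) order.                                               *)
Definition relators : seq G :=
  relators_comm ++ relators_steinberg ++
  [:: weyl 1 2 ^+ 4; a / \prod_(r <- rev (index_iota 1 n)) weyl r r.+1].

End Words.

Definition fg_a : freeGroup 'I_2 := fgen ord0.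
Definition fg_b : freeGroup 'I_2 := fgen ord_max.

(* Main.v *)
Require Import Defs.
From HB Require Import structures.
From mathcomp Require Import all_boot all_order all_algebra perm.
From mathcomp Require Import zify.

Set Implicit Arguments.
Unset Strict Implicit.
Unset Printing Implicit Defensive.

Import GRing.Theory.

(** The matrices [1 + E_ij] satisfy the Steinberg relations, and the words
    [tau_ij] evaluate to them at [(a_n, b_n)]: the matrix [a_n] is a signed
    cyclic permutation matrix, so conjugation by it shifts both indices of
    [b_n = 1 + E_21] ([conj_pow_elem]), and every further step in the
    definition of [tau_ij] is an instance of a Steinberg relation
    ([tau_elem]).  The product of Weyl elements in the last relator is [a_n]
    itself ([cycle_slE]).  Hence all relators die in SL_n(Z), and there is a
    morphism [f] from the presented group to SL_n(Z).  In the presented group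
    the [tau_ij] satisfy the Steinberg relations by construction, and they
    generate it, since [b] is [tau_21] and the last relator expresses [a]
    through them ([generators_subsystem]).  Everything thus rests on the
    following fact of Steinberg, Magnus and Milnor: for [n >= 3], if elements
    [x_ij] of a group satisfy the Steinberg relations and
    [(x_12 x_21^-1 x_12)^4 = 1], then a morphism [f] sending each [x_ij] to
    [1 + E_ij] is injective on the subgroup they generate.

    The proof is a peak reduction in the manner of Silvester.  Fix an index
    [p] and let the group act through [f] on integer row vectors; the
    generator [x_ij] adds the entry [i] to the entry [j].  Let [P] be the
    subgroup generated by the [x_ij] with [i <> p]; it fixes the unit vector
    [e_p].  The relation [label v g] attaches the coset [P g] to a vector [v]:
    for [v = e_k] or [- e_k] it is the coset of an explicit product of Weyl
    elements, and
    otherwise one descends to a vector of smaller l1 norm by a generator.  The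
    core of the proof is that labels are equivariant under every generator
    ([label_transvect]).  It goes by induction on the norm: two generators
    that both lower the norm of [v] lead to vectors that can be joined through
    vectors of norm smaller than that of [v], and the product of the
    generators met on the way is the expected one by the Steinberg relations
    ([linked_reduces]).  Weyl elements, which act by signed permutations and
    so preserve the norm, serve as additional steps ([label_w]); the relation
    of order four is what makes the labels of [- e_p] consistent
    ([sq_stabilizer]).

    If [g] is in the kernel of [f], then [g] is attached to [e_p], hence lies
    in [P] ([subsystem_fixing]).  Now [P = H T], where [H] is generated by the
    [x_ij] with [i] and [j] distinct from [p], and [T] by the [x_ip]; the group
    [T] is abelian and its elements are determined by the column [p] of their
    matrix, so that [g] lies in [H] ([stabilizer_ker]).  Induction on the
    number of indices gives [g = 1] ([subsystem_ker]).  Surjectivity of [f] is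
    the Euclidean algorithm on the rows and columns of a matrix
    ([supported_generated]). *)

(** * Subgroups generated by a set of elements *)

Section Generated.
Variables (G : groupType).
Implicit Types (S T : G -> Prop).
Local Open Scope group_scope.

Inductive generated_by S : G -> Prop :=
| generated1 : generated_by S 1
| generatedMr g s : generated_by S g -> S s -> generated_by S (g * s)
| generatedMV g s : generated_by S g -> S s -> generated_by S (g * s^-1).

Lemma generated_gen S s : S s -> generated_by S s.
Proof. by move=> Ss; rewrite -[s]mul1g; apply: generatedMr => //; exact: generated1. Qed.

Lemma generatedM S g h : generated_by S g -> generated_by S h -> generated_by S (g * h).
Proof.
move=> Sg; elim=> [|{}h s _ IH Ss|{}h s _ IH Ss]; rewrite ?mulg1 ?mulgA //.
  exact: generatedMr.
exact: generatedMV.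
Qed.

Lemma generatedV S g : generated_by S g -> generated_by S g^-1.
Proof.
elim=> [|{}h s _ IH Ss|{}h s _ IH Ss]; rewrite ?invg1; first exact: generated1.
  rewrite invgM; apply: generatedM => //; rewrite -[s^-1]mul1g.
  by apply: generatedMV => //; exact: generated1.
by rewrite invgM invgK; apply: generatedM => //; apply: generated_gen.
Qed.

Lemma generated_sub S T g :
  (forall s, S s -> generated_by T s) -> generated_by S g -> generated_by T g.
Proof.
move=> ST; elim=> [|{}h s _ IH Ss|{}h s _ IH Ss]; first exact: generated1.
  by apply: generatedM => //; apply: ST.
by apply: generatedM => //; apply/generatedV/ST.
Qed.

End Generated.

(** * Steinberg relations and Weyl elements *)

(** The third index makes every [x_ij] a commutator [[x_im, x_mj]]; this is how
    the conjugates of [x_ij] by Weyl elements on the same two indices are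
    computed. *)
Record steinberg_system (G : groupType) (I : finType) (x : I -> I -> G) :
    Prop := SteinbergSystem {
  steinberg_commute : forall i j k l,
    i != j -> k != l -> i != l -> j != k -> commute (x i j) (x k l);
  steinberg_commutator : forall i j k, i != j -> j != k -> i != k ->
    [~ x i j, x j k]%g = x i k;
  steinberg_third : forall i j : I, exists k, (k != i) && (k != j)
}.
Arguments steinberg_commute {G I x} s [i j k l] _ _ _ _.
Arguments steinberg_commutator {G I x} s [i j k] _ _ _.

Section Steinberg.
Variables (G : groupType) (I : finType) (x : I -> I -> G).
Local Open Scope group_scope.

(** The sign is a boolean, so that signs multiply by exclusive or. *)
Definition signed_gen i j (e : bool) : G := if e then (x i j)^-1 else x i j.
(** On row vectors, the corresponding matrix sends [e_i] to [e_j] and [e_j] to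
    [- e_i]. *)
Definition weyl_elt i j : G := x i j * (x j i)^-1 * x i j.

Local Notation X := signed_gen.
Local Notation w := weyl_elt.

Lemma signed_genV i j e : (X i j e)^-1 = X i j (~~ e).
Proof. by case: e => //=; rewrite invgK. Qed.

Hypothesis sx : steinberg_system x.

Lemma signed_gen_commute i j e k l f : i != j -> k != l -> i != l -> j != k ->
  commute (X i j e) (X k l f).
Proof.
move=> ij kl il jk; have c := steinberg_commute sx ij kl il jk.
have cV : commute (x i j) (X k l f) by case: f => //; apply: commuteV.
by apply: commute_sym; case: e => /=; [apply: commuteV|]; apply: commute_sym.
Qed.

Lemma signed_gen_fix i j e k l f : i != j -> k != l -> i != l -> j != k ->
  X i j e ^ X k l f = X i j e.
Proof. by move=> *; apply/conjg_fixP/commgP; apply: signed_gen_commute. Qed.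

Lemma signed_gen_conjr i j k e f : i != j -> j != k -> i != k ->
  X i j e ^ X j k f = X i j e * X i k (e (+) f).
Proof.
move=> ij jk ik.
have ac : commute (x i j) (x i k).
  by apply: (steinberg_commute sx) => //; rewrite eq_sym.
have bc : commute (x j k) (x i k).
  by apply: (steinberg_commute sx) => //; rewrite eq_sym.
have E : x i j ^ x j k = x i j * x i k.
  by rewrite -(steinberg_commutator sx ij jk ik) commgEl mulVKg.
have E' : x i j ^ (x j k)^-1 = x i j * (x i k)^-1.
  apply: (@conjg_inj _ (x j k)); rewrite conjgKV conjMg E conjVg.
  by rewrite (_ : x i k ^ x j k = x i k) ?mulgK //; apply/conjg_fixP/commgP.
case: e f => -[] /=; rewrite ?conjVg ?E ?E' //.
  by rewrite invgM invgK; apply: commuteV; apply: commute_sym.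
by rewrite ac invgM.
Qed.

Lemma signed_gen_conjl i j k e f : i != j -> j != k -> i != k ->
  X j k f ^ X i j e = X j k f * X i k (~~ (e (+) f)).
Proof.
move=> ij jk ik; have := signed_gen_conjr e f ij jk ik.
rewrite -[X i j e ^ _](mulVKg (X i j e)) -commgEl => /mulgI E.
by rewrite -signed_genV -E invgR commgEl mulVKg.
Qed.

(** When exactly one of [k], [l] is [i] or [j], the conjugate is computed one
    factor of [w i j] after the other; when both are, [x k l] is first written
    as a commutator through a third index. *)
Lemma signed_gen_conjw0 i j k l : i != j -> k != l ->
  X k l false ^ w i j =
  X (tperm i j k) (tperm i j l) ((k == j) (+) (l == j)).
Proof.
move=> ij kl; have ji : j != i by rewrite eq_sym.
have ki_w m : m != i -> m != j -> x m i ^ w i j = x m j.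
  move=> mi mj; have [im jm] : i != m /\ j != m by split; rewrite eq_sym.
  have e1 := @signed_gen_conjr m i j false false mi ij mj.
  have e2 := @signed_gen_fix m i false j i true mi ji mi ij.
  have e3 := @signed_gen_conjr m j i false true mj ji mi.
  have e4 := @signed_gen_fix m j false i j false mj ij mj ji.
  have c : x m i * x m j = x m j * x m i.
    exact: (steinberg_commute sx mi mj mj im).
  rewrite /= in e1 e2 e3 e4.
  by rewrite /weyl_elt 2!conjgM e1 (conjMg (x m i)) e2 e3 mulgA c mulgK e4.
have kj_w m : m != i -> m != j -> x m j ^ w i j = (x m i)^-1.
  move=> mi mj; have [im jm] : i != m /\ j != m by split; rewrite eq_sym.
  have e1 := @signed_gen_fix m j false i j false mj ij mj ji.
  have e2 := @signed_gen_conjr m j i false true mj ji mi.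
  have e3 := @signed_gen_conjr m i j false false mi ij mj.
  rewrite /= in e1 e2 e3.
  rewrite /weyl_elt 2!conjgM e1 e2 (conjMg (x m j)) e1 conjVg e3 invgM.
  by rewrite mulgA mulgV mul1g.
have il_w m : m != i -> m != j -> x i m ^ w i j = x j m.
  move=> mi mj; have [im jm] : i != m /\ j != m by split; rewrite eq_sym.
  have e1 := @signed_gen_fix i m false i j false im ij ij mi.
  have e2 := @signed_gen_conjl j i m true false ji im jm.
  have e3 := @signed_gen_conjl i j m false false ij jm im.
  have c : x i m * x j m = x j m * x i m.
    exact: (steinberg_commute sx im jm im mj).
  rewrite /= in e1 e2 e3.
  by rewrite /weyl_elt 2!conjgM e1 e2 (conjMg (x i m)) e1 e3 mulgA c mulgK.
have jl_w m : m != i -> m != j -> x j m ^ w i j = (x i m)^-1.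
  move=> mi mj; have [im jm] : i != m /\ j != m by split; rewrite eq_sym.
  have e1 := @signed_gen_conjl i j m false false ij jm im.
  have e2 := @signed_gen_fix j m false j i true jm ji ji mj.
  have e3 := @signed_gen_conjl j i m true false ji im jm.
  have e4 := @signed_gen_fix i m false i j false im ij ij mi.
  rewrite /= in e1 e2 e3 e4.
  rewrite /weyl_elt 2!conjgM e1 (conjMg (x j m)) e2 conjVg e3 invgM.
  by rewrite mulgA mulgV mul1g conjVg e4.
have [m /andP[mi mj]] := steinberg_third sx i j.
have [im jm] : i != m /\ j != m by split; rewrite eq_sym.
have tD q : q != i -> q != j -> tperm i j q = q.
  by move=> qi qj; rewrite tpermD // eq_sym.
have [eki|ki] := eqVneq k i.
  rewrite {}eki in kl *; rewrite (negPf ij) tpermL.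
  have [elj|lj] := eqVneq l j.
    rewrite elj tpermR /= -(steinberg_commutator sx im mj ij) conjRg il_w // kj_w //.
    have := signed_gen_conjl false true jm mi ji.
    by rewrite -invgR commgEl /= => ->; rewrite mulKg.
  by have li : l != i; rewrite 1?eq_sym // tD //= il_w.
have [ekj|kj] := eqVneq k j.
  rewrite {}ekj in kl *; rewrite tpermR (eq_sym l) (negPf kl).
  have [eli|li] := eqVneq l i.
    rewrite eli tpermL /= -(steinberg_commutator sx jm mi ji) conjRg jl_w // ki_w //.
    have := signed_gen_conjl true false im mj ij.
    by rewrite -invgR commgEl /= => ->; rewrite mulKg.
  by have lj : l != j; rewrite 1?eq_sym // tD //= jl_w.
rewrite (tD k) //=.
have [eli|li] := eqVneq l i.
  by rewrite eli tpermL (negPf ij) /= ki_w.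
have [elj|lj] := eqVneq l j.
  by rewrite elj tpermR /= kj_w.
rewrite tD //= /weyl_elt -!/(X _ _ false) -/(X j i true) !conjgM.
by rewrite !(@signed_gen_fix k l) // eq_sym.
Qed.

Lemma signed_gen_conjw i j k l e : i != j -> k != l ->
  X k l e ^ w i j =
  X (tperm i j k) (tperm i j l) (e (+) ((k == j) (+) (l == j))).
Proof.
move=> ij kl; have := signed_gen_conjw0 ij kl; case: e => //= E.
by rewrite conjVg E signed_genV.
Qed.

(** [w i j] is its own conjugate by [w i j], whereas each of its factors [x i j]
    and [x j i] is exchanged with the inverse of the other one. *)
Lemma weyl_eltV i j : i != j -> (w i j)^-1 = w j i.
Proof.
move=> ij; have ji : j != i by rewrite eq_sym.
have <- : w i j ^ w i j = w i j by rewrite conjgE mulKg.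
have e1 := signed_gen_conjw false ij ij; have e2 := signed_gen_conjw true ij ji.
rewrite /= in e1 e2; rewrite {1}/weyl_elt !conjMg e1 e2.
rewrite tpermL tpermR !eqxx (negPf ij) /=.
by rewrite !invgM !invgK mulgA.
Qed.

(** This factorization replaces a step at [j] by two steps at [i] separated by
    a signed permutation. *)
Lemma signed_gen_factor i j e : i != j ->
  X i j e = X j i e * (if e then w j i else w i j) * X j i e.
Proof.
move=> ij; have ji : j != i by rewrite eq_sym.
case: e => /=; last rewrite -(weyl_eltV ji); rewrite /weyl_elt ?invgM ?invgK !mulgA.
  by rewrite mulVg mul1g mulgK.
by rewrite mulgV mul1g mulgVK.
Qed.

Lemma weyl_elt_conj i j k l : i != j -> k != l ->
  w k l ^ w i j = if (k == j) (+) (l == j)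
    then w (tperm i j l) (tperm i j k) else w (tperm i j k) (tperm i j l).
Proof.
move=> ij kl; have lk : l != k by rewrite eq_sym.
have e1 := signed_gen_conjw false ij kl; have e2 := signed_gen_conjw true ij lk.
rewrite /= in e1 e2; rewrite {1}/weyl_elt !conjMg e1 e2 (addbC (l == j)).
case: addb => //=.
by rewrite -weyl_eltV ?(inj_eq perm_inj) // !invgM !invgK mulgA.
Qed.

(** Conjugation by Weyl elements carries any pair of indices to any other, and
    exchanging the two indices inverts the Weyl element. *)
Lemma weyl_elt_order4 i0 j0 : i0 != j0 -> w i0 j0 ^+ 4 = 1 ->
  forall i j, i != j -> w i j ^+ 4 = 1.
Proof.
have conj4 i j k l : w i j ^+ 4 = 1 -> (w i j ^ w k l) ^+ 4 = 1.
  by move=> w4; rewrite -conjXg w4 conj1g.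
have inv4 i j : i != j -> w i j ^+ 4 = 1 -> w j i ^+ 4 = 1.
  by move=> ij w4; rewrite -weyl_eltV // expVgn w4 invg1.
have right4 i j l : i != j -> l != i -> w i j ^+ 4 = 1 -> w i l ^+ 4 = 1.
  move=> ij li w4; have [->//|lj] := eqVneq l j.
  have jl : j != l by rewrite eq_sym.
  have [ji il] : j != i /\ i != l by split; rewrite eq_sym.
  have := conj4 i j j l w4; rewrite weyl_elt_conj //.
  by rewrite (negPf il) (negPf jl) tpermL tpermD.
move=> ij0 w4 i j ij; have ji : j != i by rewrite eq_sym.
have [eji|ji0] := eqVneq j i0.
  by rewrite {}eji in ij ji *; apply: inv4 => //; apply: right4 w4.
by apply/inv4/(right4 j i0)/inv4/(right4 i0 j0) => //; rewrite // eq_sym.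
Qed.

End Steinberg.

(** * Transvections of integer vectors *)

Section IntegerVectors.
Variable I : finType.
Local Open Scope ring_scope.
Implicit Types (v : {ffun I -> int}) (i j k l : I) (e f : bool).

Definition signed e (a : int) : int := if e then - a else a.

Lemma signedD f e a b :
  signed f (b + signed e a) = signed f b + signed (e (+) f) a.
Proof. by case: f; case: e => /=; lia. Qed.

Lemma signed_reduce_uniq e f (a b : int) :
  (`|(b + signed e a)%R| < `|b| -> `|(b + signed f a)%R| < `|b| -> e = f)%N.
Proof. by case: f; case: e => //=; lia. Qed.

Lemma signed_reduce_opposite e f (a b : int) :
  (`|(b + signed e a)%R| < `|b| -> `|(a + signed f b)%R| < `|a| -> e = f)%N.
Proof. by case: f; case: e => //=; lia. Qed.

(** With [b] the entry being changed and [a] the one being added: if [a] is the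
    larger of the two, the same sign reduces [a] by [b]. *)
Lemma signed_reduce_swap e (a b : int) :
  (`|b| < `|a| -> `|(b + signed e a)%R| <= `|b| -> `|(a + signed e b)%R| < `|a|)%N.
Proof. by case: e => //=; lia. Qed.

Lemma signed_reduce_exists (a b : int) : a != 0%R -> (`|a| <= `|b|)%N ->
  exists e, (`|(b + signed e a)%R| < `|b|)%N.
Proof.
move=> a0 ab; exists ((0 < a) == (0 < b))%R; move: a0 ab.
by case: (boolP (0 < a)%R); case: (boolP (0 < b)%R) => /=; lia.
Qed.

(** The effect on two entries of adding [a] to [b] and then the result to [c].
    Without [|a| <= |b|] the first step may overshoot and make the second one
    raise the norm: take [a, b, c = 7, -4, 3]. *)
Lemma signed_reduce_chain e f (a b c : int) :
  (`|a| <= `|b| -> `|(b + signed e a)%R| < `|b| -> `|(c + signed f b)%R| < `|c| ->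
   `|(b + signed e a)%R| + `|(c + signed f (b + signed e a))%R| < `|b| + `|c|)%N.
Proof. by case: f; case: e => /=; lia. Qed.

(** The product of the row vector [v] by [1 + E_ij], or by its inverse. *)
Definition transvect v i j e : {ffun I -> int} :=
  [ffun k => if k == j then v j + signed e (v i) else v k].

(** The product of the row vector [v] by the matrix of [weyl_elt x i j]. *)
Definition weyl_swap v i j : {ffun I -> int} :=
  [ffun k => signed (k == i) (v (tperm i j k))].

Definition l1norm v : nat := (\sum_k `|v k|)%N.

Definition signed_unit k e : {ffun I -> int} :=
  [ffun l => if l == k then signed e 1 else 0].

Lemma transvectK v i j e : i != j ->
  transvect (transvect v i j e) i j (~~ e) = v.
Proof.
move=> ij; apply/ffunP => k; rewrite !ffunE eqxx (negPf ij).
by case: eqP => [->|//]; case: e => /=; lia.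
Qed.

Lemma norm_transvect v i j e : i != j ->
  (l1norm (transvect v i j e) + `|v j| = l1norm v + `|(v j + signed e (v i))%R|)%N.
Proof.
move=> ij; rewrite /l1norm !(bigD1 (P := predT) j) //=.
rewrite ffunE eqxx (eq_bigr (fun k => `|v k|%N)); first by lia.
by move=> k kj; rewrite ffunE (negPf kj).
Qed.

Lemma weyl_swap_transvect v i j k l e : i != j -> k != l ->
  weyl_swap (transvect v k l e) i j =
  transvect (weyl_swap v i j) (tperm i j k) (tperm i j l)
    (e (+) ((k == j) (+) (l == j))).
Proof.
move=> ij kl; apply/ffunP => q; rewrite !ffunE !tpermK.
have tE a b : (a == tperm i j b) = (tperm i j a == b).
  by rewrite -(inj_eq (@perm_inj _ (tperm i j))) tpermK.
have kj : (k == j) = (tperm i j k == i).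
  by rewrite -(inj_eq (@perm_inj _ (tperm i j)) k) tpermR.
rewrite -tE; have [->|//] := eqVneq q (tperm i j l).
have -> : (l == j) = (tperm i j l == i).
  by rewrite -(inj_eq (@perm_inj _ (tperm i j)) l) tpermR.
by rewrite kj; case: e; do 2!case: (_ == i) => /=; lia.
Qed.

Lemma norm_weyl_swap v i j : l1norm (weyl_swap v i j) = l1norm v.
Proof.
rewrite /l1norm [RHS](reindex_inj (@perm_inj _ (tperm i j))) /=.
by apply: eq_bigr => k _; rewrite ffunE; case: eqP => //= _; lia.
Qed.

Lemma weyl_swap_unit i j k e :
  weyl_swap (signed_unit k e) i j =
  signed_unit (tperm i j k) (e (+) (k == j)).
Proof.
have kj : (k == j) = (tperm i j k == i).
  by rewrite -(inj_eq (@perm_inj _ (tperm i j)) k) tpermR.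
apply/ffunP => q; rewrite !ffunE.
rewrite -[tperm i j q == k](inj_eq (@perm_inj _ (tperm i j))) tpermK kj.
have [->|_] := eqVneq q (tperm i j k); last by case: eqP.
by case: e; case: eqP.
Qed.

Lemma norm_signed_unit k e : l1norm (signed_unit k e) = 1%N.
Proof.
rewrite /l1norm (bigD1 k) //= big1 ?ffunE ?eqxx ?addn0; first by case: e.
by move=> l lk; rewrite ffunE (negPf lk).
Qed.

(** The action on vectors of the identity [signed_gen_factor]. *)
Lemma transvect_factor v i j e : i != j ->
  transvect (weyl_swap (transvect v j i e) (if e then j else i)
                       (if e then i else j)) j i e = transvect v i j e.
Proof.
move=> ij; apply/ffunP => k; have ji : j != i by rewrite eq_sym.
case: e => /=; rewrite !ffunE !(tpermL, tpermR) !eqxx ?(negPf ij) ?(negPf ji);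
have [->|ki] := eqVneq k i;
  rewrite ?(tpermL, tpermR) ?eqxx ?(negPf ij) ?(negPf ji) /=; try lia.
all: have [->|kj] := eqVneq k j;
  rewrite ?(tpermL, tpermR) ?eqxx ?(negPf ij) ?(negPf ji) /=; try lia.
all: have [ik jk] : i != k /\ j != k by split; rewrite eq_sym.
all: by rewrite ?(negPf ki) ?(negPf kj) tpermD //= ?(negPf ki).
Qed.

Definition reduces v i j e : bool :=
  (`|(v j + signed e (v i))%R| < `|v j|)%N.

Lemma reducesP v i j e : i != j ->
  reduces v i j e = (l1norm (transvect v i j e) < l1norm v)%N.
Proof. by move=> ij; have := norm_transvect v e ij; rewrite /reduces; lia. Qed.

End IntegerVectors.

(** * Weyl elements modulo the stabilizer of a unit vector *)

Section Transporters.
Variables (G : groupType) (I : finType) (x : I -> I -> G).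
Local Open Scope group_scope.
Local Notation X := (signed_gen x).
Local Notation w := (weyl_elt x).

Hypothesis sx : steinberg_system x.
Hypothesis w4 : forall i j, i != j -> w i j ^+ 4 = 1.

Variables (D : {set I}) (p : I).
Hypothesis pD : p \in D.

Definition subsystem (g : G) : Prop :=
  exists i j, [/\ i \in D, j \in D, i != j & g = x i j].

(** These generators fix the row vector [e_p]; by [label_transvect] and
    [label_stabilizer] they generate its whole stabilizer in the group
    generated by [subsystem]. *)
Definition stabilizer_gen (g : G) : Prop :=
  exists i j, [/\ i \in D, j \in D, i != j, i != p & g = x i j].

Local Notation P := (generated_by stabilizer_gen).

Lemma stabilizerX i j e : i \in D -> j \in D -> i != j -> i != p -> P (X i j e).
Proof.
move=> iD jD ij ip; have Px : P (x i j) by apply: generated_gen; exists i, j.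
by case: e => //=; apply: generatedV.
Qed.

Lemma stabilizerw i j :
  i \in D -> j \in D -> i != j -> i != p -> j != p -> P (w i j).
Proof.
move=> iD jD ij ip jp; have ji : j != i by rewrite eq_sym.
by do !apply: generatedM; [apply: (@stabilizerX i j false)|
  apply: (@stabilizerX j i true)|apply: (@stabilizerX i j false)].
Qed.

(** [transporter k e t] provides coset representatives [t] modulo [P] that send
    [e_p] to the signed unit vector with sign [e] at [k].  For [- e_p] no index
    is distinguished, so all the [w p k ^+ 2] are allowed; [sq_stabilizer]
    shows that they lie in one coset. *)
Inductive transporter : I -> bool -> G -> Prop :=
| transporter_p : transporter p false 1
| transporter_pos k of k \in D & k != p : transporter k false (w p k)
| transporter_neg k of k \in D & k != p : transporter k true (w k p)
| transporter_Np k of k \in D & k != p : transporter p true (w p k ^+ 2).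

Lemma weyl_elt_sqV i j : i != j -> w i j ^+ 2 = w j i ^+ 2.
Proof.
move=> ij; apply/eqP.
by rewrite -(weyl_eltV sx ij) expVgn -mulg_eq1 -expgnDr w4.
Qed.

(** For distinct [k] and [j]: as [w p k ^+ 2] inverts [w k j] by conjugation and [w k j] conjugates
    [w p k] to [w p j], the product is [w k j * w p k ^+ 4 * w k j], where the
    middle factor is trivial. *)
Lemma sq_stabilizer k j : k \in D -> k != p -> j \in D -> j != p ->
  P (w p k ^+ 2 * w p j ^+ 2).
Proof.
move=> kD kp jD jp; have [pk pj] : p != k /\ p != j by split; rewrite eq_sym.
have [->|kj] := eqVneq k j.
  by rewrite -expgnDr w4 //; exact: generated1.
have jk : j != k by rewrite eq_sym.
have e1 : w p k ^ w k j = w p j.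
  by rewrite weyl_elt_conj // (negPf pj) (negPf kj) tpermL tpermD.
have e2 : w k j ^ (w p k ^+ 2) = w j k.
  rewrite expg2 conjgM weyl_elt_conj // eqxx (negPf jk) /= tpermR tpermD //.
  by rewrite weyl_elt_conj // (negPf jk) (negPf pk) tpermL tpermD.
have e3 : w p j ^+ 2 = w j k * w p k ^+ 2 * w k j.
  by rewrite -e1 -conjXg conjgE weyl_eltV // mulgA.
have e4 : w p k ^+ 2 * w j k = w k j * w p k ^+ 2.
  by rewrite -e2 conjgE mulVKg.
rewrite e3 mulgA (mulgA (w p k ^+ 2) (w j k)) e4 -(mulgA (w k j)) -expgnDr w4 //.
rewrite mulg1.
by apply: generatedM; apply: stabilizerw.
Qed.

Lemma transporter_conjw k s t i j : transporter k s t ->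
  i \in D -> j \in D -> i != j -> i != p -> j != p ->
  transporter (tperm i j k) (s (+) (k == j)) (t ^ w i j).
Proof.
move=> Tt iD jD ij ip jp; have ji : j != i by rewrite eq_sym.
have [pj pi] : p != j /\ p != i by split; rewrite eq_sym.
have tp : tperm i j p = p by rewrite tpermD.
have tD k' : k' \in D -> tperm i j k' \in D by case: tpermP => // ->.
have tNp k' : k' != p -> tperm i j k' != p by rewrite -{2}tp (inj_eq perm_inj).
case: Tt => [|k' kD kp|k' kD kp|k' kD kp]; try have pk : p != k' by rewrite eq_sym.
- by rewrite conj1g tp (negPf pj); exact: transporter_p.
- rewrite weyl_elt_conj // tp (negPf pj) /=.
  by case: (k' == j); constructor; auto.
- rewrite weyl_elt_conj // tp (negPf pj) addbF.
  by case: (k' == j); constructor; auto.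
- rewrite conjXg weyl_elt_conj // tp (negPf pj) /=.
  by case: (k' == j); [rewrite weyl_elt_sqV ?tNp //|]; constructor; auto.
Qed.

(** If [i] and [j] both differ from [p], then [w i j] is in [P] and conjugates
    transporters to transporters.  If one of them is [p], then either [w i j]
    moves the vector [e_k] and the new transporter is read off, or [w i j]
    conjugated back by [t] is a Weyl element avoiding [p]. *)
Lemma transporter_w k s t i j : transporter k s t ->
  i \in D -> j \in D -> i != j ->
  exists2 t', transporter (tperm i j k) (s (+) (k == j)) t' &
              P (t * w i j * t'^-1).
Proof.
move=> Tt iD jD ij; have ji : j != i by rewrite eq_sym.
have [eip|ip] := eqVneq i p; last have [ejp|jp] := eqVneq j p.
- rewrite {}eip in ij ji iD *.
  case: Tt => [|k' kD kp|k' kD kp|k' kD kp].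
  + exists (w p j); first by rewrite tpermL (negPf ij); constructor.
    by rewrite mul1g mulgV; exact: generated1.
  + have pk : p != k' by rewrite eq_sym.
    have [->|kj] := eqVneq k' j.
      exists (w p j ^+ 2); first by rewrite tpermR; constructor.
      by rewrite expg2 mulgV; exact: generated1.
    have jk : j != k' by rewrite eq_sym.
    exists (w p k'); first by rewrite tpermD //; constructor.
    rewrite -{1}(weyl_eltV sx kp) (weyl_eltV sx pk) -mulgA -conjgE weyl_elt_conj //.
    by rewrite eqxx (negPf ji) tpermD // tpermR; apply: stabilizerw.
  + have pk : p != k' by rewrite eq_sym.
    have [->|kj] := eqVneq k' j.
      exists 1; first by rewrite tpermR; constructor.
      by rewrite -weyl_eltV // mulVg invg1 mulg1; exact: generated1.
    have jk : j != k' by rewrite eq_sym.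
    exists (w k' p); first by rewrite tpermD //; constructor.
    rewrite -{1}(weyl_eltV sx pk) (weyl_eltV sx kp) -mulgA -conjgE weyl_elt_conj //.
    by rewrite (negPf pk) (negPf jk) tpermD // tpermL; apply: stabilizerw.
  + exists (w j p); first by rewrite tpermL (negPf ij); constructor.
    by rewrite weyl_eltV // -mulgA -expg2; apply: sq_stabilizer.
- rewrite {}ejp in ij ji jD *.
  case: Tt => [|k' kD kp|k' kD kp|k' kD kp].
  + exists (w i p); first by rewrite tpermR eqxx; constructor.
    by rewrite mul1g mulgV; exact: generated1.
  + have pk : p != k' by rewrite eq_sym.
    rewrite (negPf kp); have [->|ki] := eqVneq k' i.
      exists 1; first by rewrite tpermL; constructor.
      by rewrite -weyl_eltV // mulVg invg1 mulg1; exact: generated1.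
    have ik : i != k' by rewrite eq_sym.
    exists (w p k'); first by rewrite tpermD //; constructor.
    rewrite -{1}(weyl_eltV sx kp) (weyl_eltV sx pk) -mulgA -conjgE weyl_elt_conj //.
    by rewrite (negPf ip) eqxx tpermR tpermD //; apply: stabilizerw.
  + have pk : p != k' by rewrite eq_sym.
    rewrite (negPf kp); have [->|ki] := eqVneq k' i.
      exists (w p i ^+ 2); first by rewrite tpermL; constructor.
      rewrite -expg2 -(weyl_eltV sx ij) expVgn invgK -expgnDr w4 //; exact: generated1.
    have ik : i != k' by rewrite eq_sym.
    exists (w k' p); first by rewrite tpermD //; constructor.
    rewrite -{1}(weyl_eltV sx pk) (weyl_eltV sx kp) -mulgA -conjgE weyl_elt_conj //.
    by rewrite (negPf ik) (negPf pk) tpermL tpermD //; apply: stabilizerw.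
  + exists (w p i); first by rewrite tpermR eqxx; constructor.
    rewrite weyl_eltV // -mulgA -expg2.
    by rewrite (weyl_elt_sqV ip); apply: sq_stabilizer.
- exists (t ^ w i j); first exact: transporter_conjw.
  by rewrite (conjgC t) mulgK; apply: stabilizerw.
Qed.

(** The generator fixes [e_k], so conjugating it back by [t] gives a generator
    that fixes [e_p]. *)
Lemma transporter_X k s t i j e : transporter k s t ->
  i \in D -> j \in D -> i != j -> i != k -> P (t * X i j e * t^-1).
Proof.
have tD a b c : a \in D -> b \in D -> c \in D -> tperm a b c \in D.
  by move=> aD bD cD; case: tpermP.
move=> Tt iD jD ij ik; case: Tt ik => [|k' kD kp|k' kD kp|k' kD kp] ik.
- by rewrite mul1g invg1 mulg1; apply: stabilizerX.
- have pk : p != k' by rewrite eq_sym.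
  rewrite -{1}(weyl_eltV sx kp) (weyl_eltV sx pk) -mulgA -conjgE signed_gen_conjw //.
  apply: stabilizerX; rewrite ?(inj_eq perm_inj) ?tD //.
  by rewrite -(inj_eq (@perm_inj _ (tperm k' p))) tpermK tpermR.
- have pk : p != k' by rewrite eq_sym.
  rewrite -{1}(weyl_eltV sx pk) (weyl_eltV sx kp) -mulgA -conjgE signed_gen_conjw //.
  apply: stabilizerX; rewrite ?(inj_eq perm_inj) ?tD //.
  by rewrite -(inj_eq (@perm_inj _ (tperm p k'))) tpermK tpermL.
- have pk : p != k' by rewrite eq_sym.
  rewrite -(weyl_eltV sx kp) expVgn invgK -mulgA -conjgE expg2 conjgM.
  rewrite !signed_gen_conjw ?(inj_eq perm_inj) // !tpermK.
  exact: stabilizerX.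
Qed.

End Transporters.

(** * Labelling integer vectors by cosets *)

Section Labels.
Variables (G : groupType) (I : finType) (x : I -> I -> G).
Local Open Scope group_scope.
Local Notation X := (signed_gen x).
Local Notation w := (weyl_elt x).

Hypothesis sx : steinberg_system x.
Hypothesis w4 : forall i j, i != j -> w i j ^+ 4 = 1.

Variables (D : {set I}) (p : I).
Hypothesis pD : p \in D.
Local Notation P := (generated_by (stabilizer_gen x D p)).
Local Notation transporter := (transporter x D p).

(** [label v g] says that the coset [P g] is attached to [v].  The descent is
    not deterministic: a vector usually has several reducing generators, and
    their agreement is what [linked_reduces] establishes. *)
Inductive label : {ffun I -> int} -> G -> Prop :=
| label_base k e t g : transporter k e t -> P (g * t^-1) -> label (signed_unit k e) g
| label_step v g i j e : i \in D -> j \in D -> i != j ->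
    (l1norm (transvect v i j e) < l1norm v)%N ->
    label (transvect v i j e) (g * X i j e) -> label v g.

Lemma label_norm_gt0 v g : label v g -> (0 < l1norm v)%N.
Proof.
elim=> [k e t {}g _ _|{}v {}g i j e _ _ _ lt_n _ n0]; last exact: leq_ltn_trans lt_n.
by rewrite norm_signed_unit.
Qed.

(** Weyl elements permute the signed generators and preserve the norm, hence
    carry a descent from [v] to a descent from its image. *)
Lemma label_w v g i j : i \in D -> j \in D -> i != j ->
  label v g -> label (weyl_swap v i j) (g * w i j).
Proof.
move=> iD jD ij; elim=> [k e t {}g Tt Pg|{}v {}g k l e kD lD kl lt_n _ IH].
  have [t' Tt' Pt'] := transporter_w sx w4 Tt iD jD ij.
  rewrite weyl_swap_unit; apply: label_base Tt' _.
  by have := generatedM Pg Pt'; rewrite !mulgA mulgVK.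
have tD a : a \in D -> tperm i j a \in D by case: tpermP => // ->.
rewrite weyl_swap_transvect // -mulgA (conjgC (X k l e)) signed_gen_conjw // mulgA in IH.
have tkl : tperm i j k != tperm i j l by rewrite (inj_eq perm_inj).
apply: label_step (tD _ kD) (tD _ lD) tkl _ IH.
by rewrite -weyl_swap_transvect // !norm_weyl_swap.
Qed.

Lemma label_increase v g i j e : i \in D -> j \in D -> i != j ->
  (l1norm v < l1norm (transvect v i j e))%N ->
  label v g -> label (transvect v i j e) (g * X i j e).
Proof.
move=> iD jD ij lt_n vg; apply: (@label_step _ _ i j (~~ e)) => //.
  by rewrite transvectK.
by rewrite transvectK // -signed_genV mulgK.
Qed.

(** The induction step for [label_transvect]: equivariance is assumed between
    vectors of norm at most [N], and the moves from a vector [v] of norm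
    at most [N.+1] are studied. *)
Section Bounded.
Variable N : nat.
Hypothesis equivariant : forall v g i j e, i \in D -> j \in D -> i != j ->
  (l1norm v <= N)%N -> (l1norm (transvect v i j e) <= N)%N ->
  label v g -> label (transvect v i j e) (g * X i j e).

Lemma equivariant_iff v g i j e : i \in D -> j \in D -> i != j ->
  (l1norm v <= N)%N -> (l1norm (transvect v i j e) <= N)%N ->
  label v g <-> label (transvect v i j e) (g * X i j e).
Proof.
move=> iD jD ij vN vxN; split; first exact: equivariant.
move=> /(@equivariant _ _ i j (~~ e) iD jD ij vxN).
by rewrite transvectK // -signed_genV mulgK; apply.
Qed.

Lemma equivariant_up v g i j e : i \in D -> j \in D -> i != j ->
  (l1norm v <= N)%N -> (l1norm (transvect v i j e) <= N.+1)%N ->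
  label v g -> label (transvect v i j e) (g * X i j e).
Proof.
move=> iD jD ij vN; rewrite leq_eqVlt => /orP[/eqP vxN|]; last exact: equivariant.
by apply: label_increase; rewrite // vxN.
Qed.

Variable v : {ffun I -> int}.
Hypothesis vN : (l1norm v <= N.+1)%N.

Local Notation reduces := (reduces v).

Lemma reduces_le i j e : i != j -> reduces i j e ->
  (l1norm (transvect v i j e) <= N)%N.
Proof. by move=> ij; rewrite reducesP //; lia. Qed.

(** Both sides are the labels of [v] read after a first step; [linked] says that
    the two steps define the same labels for [v]. *)
Definition linked i j e k l f := forall g,
  label (transvect v i j e) (g * X i j e) <-> label (transvect v k l f) (g * X k l f).

(** By [signed_gen_factor], the step by [x_ij] is a step by [x_ji], a Weyl
    element, and a step by [x_ji]; the vectors in between have the norm of the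
    first one reached, which is at most [N]. *)
Lemma opposite_step i j e g : i \in D -> j \in D -> i != j ->
  reduces j i e -> (l1norm (transvect v i j e) <= N.+1)%N ->
  label (transvect v j i e) (g * X j i e) -> label (transvect v i j e) (g * X i j e).
Proof.
move=> iD jD ij red le_vx; have ji : j != i by rewrite eq_sym.
move=> vyg; rewrite signed_gen_factor // -transvect_factor // !mulgA.
apply: equivariant_up => //.
- by rewrite norm_weyl_swap reduces_le.
- by rewrite transvect_factor.
- by case: e {red le_vx} vyg => vyg; apply: label_w.
Qed.

Lemma linked_opposite i j e : i \in D -> j \in D -> i != j ->
  reduces i j e -> reduces j i e -> linked i j e j i e.
Proof.
move=> iD jD ij rx ry g; have ji : j != i by rewrite eq_sym.
by split; apply: opposite_step => //; apply/leqW/reduces_le.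
Qed.

(** The two steps change different entries, by amounts that do not interfere:
    performing both closes a square whose fourth vertex is even lower. *)
Lemma linked_commute i j e k l f :
  i \in D -> j \in D -> k \in D -> l \in D ->
  i != j -> k != l -> i != l -> j != k -> j != l ->
  reduces i j e -> reduces k l f -> linked i j e k l f.
Proof.
move=> iD jD kD lD ij kl il jk jl rx ry g.
have lj : l != j by rewrite eq_sym.
have xy : transvect (transvect v i j e) k l f = transvect (transvect v k l f) i j e.
  apply/ffunP => q; rewrite !ffunE (negPf lj) (negPf il) (negPf jl) (eq_sym k) (negPf jk).
  by have [->|//] := eqVneq q l; rewrite (negPf lj).
have nxy : (l1norm (transvect (transvect v i j e) k l f) <= N)%N.
  rewrite -(leq_add2r `|v l|%N); have := norm_transvect (transvect v i j e) f kl.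
  rewrite !ffunE (negPf lj) (eq_sym k) (negPf jk) => ->.
  by apply: leq_add; [exact: reduces_le | exact: ltnW].
rewrite (equivariant_iff _ kD lD kl _ nxy) ?reduces_le //.
rewrite xy in nxy *.
rewrite [label (transvect v k l f) _](equivariant_iff _ iD jD ij _ nxy) ?reduces_le //.
have -> // : g * X i j e * X k l f = g * X k l f * X i j e.
by rewrite -!mulgA; congr (_ * _); apply: signed_gen_commute.
Qed.

(** The path from the first vector to the second one is [x_jl], then the inverse
    of [x_il], then the inverse of [x_ij]; its product is right because
    [[x_ij, x_jl] = x_il].  The bound [|v_i| <= |v_j|] keeps the vertex after
    [x_jl] below the norm of [v]. *)
Lemma linked_steinberg_direct i j e l f :
  i \in D -> j \in D -> l \in D -> i != j -> j != l -> i != l ->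
  (`|v i| <= `|v j|)%N ->
  reduces i j e -> reduces j l f -> linked i j e j l f.
Proof.
move=> iD jD lD ij jl il vij rx ry g.
have [ji [lj li]] : j != i /\ l != j /\ l != i by split; rewrite ?(eq_sym l) // eq_sym.
pose y_x := transvect (transvect v j l f) i j e.
have xy : transvect (transvect v i j e) j l f = transvect y_x i l (e (+) f).
  apply/ffunP => q; rewrite /y_x !ffunE !eqxx (negPf lj) (negPf il) (negPf jl) (negPf ij).
  have [_|_] := eqVneq q l; first by rewrite signedD addrA.
  by [].
have [nx ny] := (reduces_le ij rx, reduces_le jl ry).
have nxy : (l1norm (transvect (transvect v i j e) j l f) <= N)%N.
  have := norm_transvect (transvect v i j e) f jl.
  have := norm_transvect v e ij; have := signed_reduce_chain vij rx ry.
  by move: vN; rewrite !ffunE eqxx (negPf lj); clear; lia.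
have nyx : (l1norm y_x <= N)%N.
  have := norm_transvect (transvect v j l f) e ij.
  by move: rx ny; rewrite /reduces !ffunE (negPf il) (negPf jl) -/y_x; clear; lia.
rewrite (equivariant_iff _ jD lD jl nx nxy) xy.
rewrite [label (transvect v j l f) _](equivariant_iff _ iD jD ij ny nyx).
rewrite xy in nxy.
rewrite [label y_x _](equivariant_iff _ iD lD il nyx nxy).
have -> // : g * X i j e * X j l f = g * X j l f * X i j e * X i l (e (+) f).
rewrite -!mulgA; congr (_ * _).
by rewrite (conjgC (X i j e)) signed_gen_conjr.
Qed.

(** When [|v_i| > |v_j|], the step by [x_ji] reduces as well: it is linked to
    the one by [x_ij] through a Weyl element, and it commutes with [x_jl]. *)
Lemma linked_steinberg i j e l f :
  i \in D -> j \in D -> l \in D -> i != j -> j != l -> i != l ->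
  reduces i j e -> reduces j l f -> linked i j e j l f.
Proof.
move=> iD jD lD ij jl il rx ry.
have [le_ij|lt_ji] := leqP `|v i| `|v j|; first exact: linked_steinberg_direct.
have [ji [lj li]] : j != i /\ l != j /\ l != i by split; rewrite ?(eq_sym l) // eq_sym.
have rz : reduces j i e.
  by apply: signed_reduce_swap lt_ji _; apply: ltnW.
move=> g; rewrite (linked_opposite iD jD ij rx rz).
exact: linked_commute.
Qed.

(** Performing both steps may raise the norm.  If [|v_k| <= |v_i|], one goes
    instead through a reducing step by [x_ki], which is in Steinberg position
    with [x_ij] and commutes with [x_kj]. *)
Lemma linked_target i j e k f :
  i \in D -> j \in D -> k \in D -> i != j -> k != j -> i != k ->
  reduces i j e -> reduces k j f -> linked i j e k j f.
Proof.
move=> iD jD kD; wlog le_ki : i k e f iD kD / (`|v k| <= `|v i|)%N => [Hw|].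
  have [le_ki|lt_ik] := leqP `|v k| `|v i|; first exact: Hw.
  move=> ij kj ik rx ry g; apply: iff_sym.
  by apply: Hw => //; [exact: ltnW | rewrite eq_sym].
move=> ij kj ik rx ry; have [ki jk] : k != i /\ j != k by split; rewrite eq_sym.
have [b rz] : exists b, reduces k i b.
  apply: signed_reduce_exists le_ki; apply: contraTneq ry => vk0.
  by rewrite /reduces vk0; case: f => /=; rewrite ?oppr0 addr0 ltnn.
move=> g; rewrite -(linked_steinberg kD iD jD ki ij kj rz rx).
exact: linked_commute.
Qed.

Lemma linked_reduces i j e k l f :
  i \in D -> j \in D -> i != j -> k \in D -> l \in D -> k != l ->
  reduces i j e -> reduces k l f -> linked i j e k l f.
Proof.
move=> iD jD ij kD lD kl rx ry.
have [ejl|jl] := eqVneq j l.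
  rewrite -{}ejl in lD kl ry *; have [eik|ik] := eqVneq i k.
    by rewrite -{}eik in kD kl ry *; rewrite (signed_reduce_uniq rx ry).
  exact: linked_target.
have [ejk|jk] := eqVneq j k; have [eil|il] := eqVneq i l.
- rewrite -{}ejk -{}eil in ry *.
  have ef := signed_reduce_opposite rx ry; rewrite ef in rx *.
  exact: linked_opposite.
- by rewrite -{}ejk in ry kl *; apply: linked_steinberg.
- rewrite -{}eil in ry kl *; have kj : k != j by rewrite eq_sym.
  by move=> g; apply: iff_sym; apply: (linked_steinberg kD iD jD).
- exact: linked_commute.
Qed.

(** Here [x_ij] fixes [v].  It also fixes the vector reached by the given
    descent, since that step does not involve the entry [i]; commuting the two
    steps creates at most an extra factor [x_il], which fixes it too. *)
Lemma fixing_step i j e k l f g :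
  i \in D -> j \in D -> i != j -> k \in D -> l \in D -> k != l ->
  v i = 0%R -> reduces k l f ->
  label (transvect v k l f) (g * X k l f) -> label (transvect v i j e) (g * X i j e).
Proof.
move=> iD jD ij kD lD kl vi0 ry vyg.
have [ki li] : k != i /\ l != i.
  split; apply/eqP => E; move: ry; rewrite /reduces E vi0.
    by case: f {vyg} => /=; rewrite ?oppr0 addr0 ltnn.
  by rewrite absz0 ltn0.
have [ik il] : i != k /\ i != l by split; rewrite eq_sym.
have fixed (u : {ffun I -> int}) q d : q != i -> u i = 0%R -> transvect u i q d = u.
  move=> qi ui0; apply/ffunP => r; rewrite ffunE ui0.
  by have [->|//] := eqVneq r q; case: d; rewrite /= ?oppr0 addr0.
have nvy := reduces_le kl ry.
have vyi : transvect v k l f i = 0%R by rewrite ffunE (negPf il).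
have ji : j != i by rewrite eq_sym.
have fix_rep h q d : q \in D -> q != i ->
    label (transvect v k l f) h -> label (transvect v k l f) (h * X i q d).
  move=> qD qi vyh; rewrite -(fixed _ q d qi vyi).
  by apply: equivariant; rewrite ?fixed // eq_sym.
rewrite fixed //; apply: (@label_step _ _ k l f) => //; first by rewrite -reducesP.
have [ejk|jk] := eqVneq j k; last first.
  by rewrite -mulgA (signed_gen_commute sx e f ij kl il jk) mulgA; apply: fix_rep.
rewrite -{}ejk in kl vyg fix_rep *.
rewrite -mulgA (conjgC (X i j e)) signed_gen_conjr // !mulgA.
by apply/(fix_rep _ _ _ lD li)/(fix_rep _ _ _ jD ji).
Qed.

(** A step that preserves the norm without fixing [v] replaces [v_j] by
    [- v_j], so that [|v_i| = 2 |v_j|]; then [x_ji] reduces [v] and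
    [opposite_step] applies. *)
Lemma reducing_step i j e k l f g :
  i \in D -> j \in D -> i != j -> k \in D -> l \in D -> k != l ->
  (l1norm (transvect v i j e) <= N.+1)%N -> reduces k l f ->
  label (transvect v k l f) (g * X k l f) -> label (transvect v i j e) (g * X i j e).
Proof.
move=> iD jD ij kD lD kl le_vx ry vyg; have ji : j != i by rewrite eq_sym.
have vg : label v g by apply: label_step vyg => //; rewrite -reducesP.
have [up|] := ltnP (l1norm v) (l1norm (transvect v i j e)).
  exact: label_increase.
have [rx _|nrx le_x] := boolP (reduces i j e).
  by apply/(linked_reduces kD lD kl iD jD ij ry rx).
have [vi0|vi_neq0] := eqVneq (v i) 0%R.
  exact: fixing_step vi0 ry vyg.
have le_j : (`|(v j + signed e (v i))%R| <= `|v j|)%N.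
  by move: le_x; have := norm_transvect v e ij; clear; lia.
have rz : reduces j i e.
  apply: (signed_reduce_swap _ le_j); move: nrx le_j vi_neq0; rewrite /reduces; clear.
  by case: e => /=; lia.
apply: opposite_step => //.
exact/(linked_reduces kD lD kl jD iD ji ry rz).
Qed.

End Bounded.

Theorem label_transvect v g i j e : i \in D -> j \in D -> i != j ->
  label v g -> label (transvect v i j e) (g * X i j e).
Proof.
have bounded N : forall u h a b c, a \in D -> b \in D -> a != b ->
    (l1norm u <= N)%N -> (l1norm (transvect u a b c) <= N)%N ->
    label u h -> label (transvect u a b c) (h * X a b c).
  elim: N => [|N IH] {}v {}g {}i {}j {}e iD jD ij vN vxN vg.
    by move: (label_norm_gt0 vg) vN; case: l1norm.
  case: vg vN vxN => [k s t {}g Tt Pg vN vxN|{}v {}g k l f kD lD kl lt_y vyg vN vxN]; last first.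
    by apply: (reducing_step IH vN iD jD ij kD lD kl vxN _ vyg); rewrite reducesP.
  have [up|] := ltnP (l1norm (signed_unit k s)) (l1norm (transvect (signed_unit k s) i j e)).
    by apply: label_increase up _ => //; apply: label_base Tt Pg.
  have := norm_transvect (signed_unit k s) e ij.
  have [eik|ik] := eqVneq i k.
    rewrite -eik !ffunE eqxx (eq_sym j) (negPf ij).
    by case: e {vxN}; case: s {Tt vN} => /=; clear; lia.
  move=> _ _; have -> : transvect (signed_unit k s) i j e = signed_unit k s.
    apply/ffunP => q; rewrite !ffunE (negPf ik).
    by have [->|//] := eqVneq q j; case: e {vxN} => /=; case: eqP; lia.
  apply: (label_base Tt).
  have := generatedM Pg (transporter_X sx pD e Tt iD jD ij ik).
  by rewrite !mulgA mulgVK.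
(* The larger of the two norms covers steps in both directions. *)
move=> iD jD ij; apply: (bounded (maxn (l1norm v) (l1norm (transvect v i j e)))) => //.
  exact: leq_maxl.
exact: leq_maxr.
Qed.

(** No vector of norm one admits a descent, and the only transporter for [e_p]
    itself is 1. *)
Lemma label_stabilizer g : label (signed_unit p false) g -> P g.
Proof.
move Ev: (signed_unit p false) => v vg.
have n1 : l1norm v = 1%N by rewrite -Ev norm_signed_unit.
case: vg Ev n1 => [k e t {}g Tt Pg|{}v {}g i j e _ _ _ lt_n vyg _ n1].
  move=> /ffunP/(_ p); rewrite !ffunE eqxx.
  have [epk|//] := eqVneq p k.
  case: Tt epk Pg => [|k' kD kp|k' kD kp|k' kD kp] // epk.
    by rewrite invg1 mulg1.
  by rewrite epk eqxx in kp.
by move: (label_norm_gt0 vyg) lt_n; rewrite n1; case: l1norm.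
Qed.

End Labels.

(** * The kernel and the image in the special linear group *)

Section Realisation.
Variables (n : nat) (G : groupType) (x : 'I_n -> 'I_n -> G).
Variable f : UMagmaMorphism.type G (specialLinear int n).
Local Open Scope group_scope.
Local Notation X := (signed_gen x).
Local Notation w := (weyl_elt x).
Local Notation SL := (specialLinear int n).

Hypothesis sx : steinberg_system x.
Hypothesis w4 : forall i j, i != j -> w i j ^+ 4 = 1.
Hypothesis fx : forall i j, i != j ->
  slval (f (x i j)) = (1%:M + delta_mx i j)%R.

Lemma slvalM (A B : SL) : slval (A * B) = (slval A *m slval B)%R.
Proof. by []. Qed.

(** Rows and columns are finite functions rather than matrices, to share the
    combinatorics of [transvect]. *)
Definition row_vec (A : SL) p : {ffun 'I_n -> int} := [ffun k => slval A p k].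
Definition col_vec (A : SL) p : {ffun 'I_n -> int} := [ffun k => slval A k p].

Lemma row_vec1 p : row_vec 1 p = signed_unit p false.
Proof. by apply/ffunP => k; rewrite !ffunE mxE eq_sym; case: eqP. Qed.

Lemma row_vecX A p i j e : i != j ->
  row_vec (A * f (X i j e)) p = transvect (row_vec A p) i j e.
Proof.
move=> ij; have row_x B : row_vec (B * f (x i j)) p = transvect (row_vec B p) i j false.
  apply/ffunP => k; rewrite !ffunE slvalM fx // mulmxDr mulmx1 !mxE.
  rewrite (bigD1 i) //= mxE eqxx big1 => [|l li]; last first.
    by rewrite mxE (negPf li) mulr0.
  by have [->|kj] := eqVneq k j; rewrite /= ?mulr1 ?mulr0 addr0 ?addr0.
case: e => //=; rewrite -[in RHS](mulgVK (f (x i j)) A) row_x.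
by rewrite -[true]/(~~ false) transvectK // gmulfV.
Qed.

Lemma col_vecX A q i j e : i != j ->
  col_vec (f (X i j e) * A) q = transvect (col_vec A q) j i e.
Proof.
move=> ij; have ji : j != i by rewrite eq_sym.
have col_x B : col_vec (f (x i j) * B) q = transvect (col_vec B q) j i false.
  apply/ffunP => k; rewrite !ffunE slvalM fx // mulmxDl mul1mx !mxE.
  rewrite (bigD1 j) //= mxE eqxx big1 => [|l lj]; last first.
    by rewrite mxE (negPf lj) andbF mul0r.
  by have [->|ki] := eqVneq k i; rewrite /= ?mul1r ?mul0r addr0 ?addr0.
case: e => //=; rewrite -[in RHS](mulVKg (f (x i j)) A) col_x.
by rewrite -[true]/(~~ false) transvectK // gmulfV.
Qed.

Lemma row_vec_w A p i j : i != j ->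
  row_vec (A * f (w i j)) p = weyl_swap (row_vec A p) i j.
Proof.
move=> ij; have ji : j != i by rewrite eq_sym.
rewrite /weyl_elt !gmulfM !mulgA (row_vecX _ _ false ij) (@row_vecX _ _ j i true) //.
rewrite (row_vecX _ _ false ij).
apply/ffunP => k; rewrite !ffunE !eqxx (negPf ij) (negPf ji).
have [->|ki] := eqVneq k i; first by rewrite (negPf ij) tpermL /=; lia.
have [->|kj] := eqVneq k j; first by rewrite tpermR /=; lia.
by rewrite tpermD // eq_sym.
Qed.

Definition supported (E : {set 'I_n}) (A : SL) : Prop :=
  forall i j, (i \notin E) || (j \notin E) -> slval A i j = (i == j)%:R%R.

Lemma supportedX E (A : SL) i j e : supported E A -> i \in E -> j \in E -> i != j ->
  supported E (A * f (X i j e)).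
Proof.
move=> sA iE jE ij q k qk; have /ffunP/(_ k) := row_vecX A q e ij.
rewrite !ffunE => ->; have [ekj|kj] := eqVneq k j; last exact: sA.
rewrite ekj jE orbF in qk; rewrite ekj !sA ?qk //.
have [-> ->] : (q == i) = false /\ (q == j) = false; last by case: e.
by split; apply: contraNF qk => /eqP ->.
Qed.

Lemma supported_f D g : generated_by (subsystem x D) g -> supported D (f g).
Proof.
elim=> [|h s _ IH [i [j [iD jD ij ->]]]|h s _ IH [i [j [iD jD ij ->]]]].
- by move=> i j _; rewrite gmulf1 mxE.
- by rewrite gmulfM; apply: (@supportedX _ _ i j false).
- by rewrite gmulfM; apply: (@supportedX _ _ i j true).
Qed.

Section Kernel.
Variables (D : {set 'I_n}) (p : 'I_n).
Hypothesis pD : p \in D.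

Lemma subsystem_fixing g :
  generated_by (subsystem x D) g -> row_vec (f g) p = signed_unit p false ->
  generated_by (stabilizer_gen x D p) g.
Proof.
move=> Dg row_g; apply: (label_stabilizer (x := x)); rewrite -row_g.
elim: Dg => [|h s _ IH [i [j [iD jD ij ->]]]|h s _ IH [i [j [iD jD ij ->]]]].
- rewrite gmulf1 row_vec1; apply: label_base (transporter_p _ _ _) _.
  by rewrite mulgV; exact: generated1.
- rewrite gmulfM (row_vecX _ _ false ij).
  exact: (label_transvect sx w4 pD false iD jD ij IH).
- rewrite gmulfM (row_vecX _ _ true ij).
  exact: (label_transvect sx w4 pD true iD jD ij IH).
Qed.

Definition column_gen (g : G) : Prop :=
  exists i, [/\ i \in D, i != p & g = x i p].

Local Notation T := (generated_by column_gen).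

Lemma column_conj t i j e : T t ->
  i \in D -> j \in D -> i != j -> i != p -> j != p -> T (t ^ X i j e).
Proof.
move=> Tt iD jD ij ip jp; have pi : p != i by rewrite eq_sym.
have gen k : k \in D -> k != p -> T (X k p false ^ X i j e).
  move=> kD kp; have Tk : T (X k p false) by apply: generated_gen; exists k.
  have [ekj|kj] := eqVneq k j.
    rewrite {}ekj in kD Tk kp *; rewrite signed_gen_conjl //; apply: generatedM => //.
    have Ti : T (x i p) by apply: generated_gen; exists i.
    by case: (~~ _) => //=; apply: generatedV.
  by rewrite signed_gen_fix.
elim: Tt => [|h s _ IH [k [kD kp ->]]|h s _ IH [k [kD kp ->]]].
- by rewrite conj1g; exact: generated1.
- by rewrite conjMg; apply: generatedM => //; apply: gen.
- by rewrite conjMg conjVg; apply: generatedM => //; apply/generatedV/gen.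
Qed.

(** The subgroup [T] is normalized by the [x_ij] with [i] and [j] distinct from
    [p] ([column_conj]), so the factors [x_ip] can be pushed to the right. *)
Lemma stabilizer_factor g : generated_by (stabilizer_gen x D p) g ->
  exists h t, [/\ generated_by (subsystem x (D :\ p)) h, T t & g = h * t].
Proof.
have step h t i j e : i \in D -> j \in D -> i != j -> i != p ->
    generated_by (subsystem x (D :\ p)) h -> T t ->
  exists h' t', [/\ generated_by (subsystem x (D :\ p)) h', T t' &
    h * t * X i j e = h' * t'].
  move=> iD jD ij ip Hh Tt; have [ejp|jp] := eqVneq j p.
    exists h, (t * X i j e); rewrite mulgA; split=> //; apply: generatedM => //.
    have Ti : T (x i j) by apply: generated_gen; exists i; rewrite ejp.
    by case: e => //=; apply: generatedV.
  exists (h * X i j e), (t ^ X i j e); split; last first.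
  - by rewrite -!mulgA -conjgC.
  - exact: column_conj.
  apply: generatedM => //.
  have Hij : generated_by (subsystem x (D :\ p)) (x i j).
    by apply: generated_gen; exists i, j; rewrite !inE ip jp.
  by case: e => //=; apply: generatedV.
elim=> [|h s _ [h' [t' [Hh' Tt' ->]]] [i [j [iD jD ij ip ->]]]
        |h s _ [h' [t' [Hh' Tt' ->]]] [i [j [iD jD ij ip ->]]]].
- by exists 1, 1; split; rewrite ?mulg1 //; exact: generated1.
- exact: (step _ _ i j false).
- exact: (step _ _ i j true).
Qed.

Definition expgz (g : G) (c : int) : G :=
  match c with Posz k => g ^+ k | Negz k => g ^- k.+1 end.

Lemma expgzS g c : expgz g (c + 1)%R = expgz g c * g.
Proof.
case: c => [k|[|k]].
- by rewrite -PoszD addn1 /= expgSr.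
- by rewrite NegzE addNr /= expg1 mulVg.
- have -> : (Negz k.+1 + 1 = Negz k)%R by lia.
  by rewrite /= (expgS _ k.+1) invgM mulgVK.
Qed.

Lemma commute_expgz g h c : commute g h -> commute g (expgz h c).
Proof.
by case: c => k c /=; [|apply: commuteV]; apply: commuteX.
Qed.

(** The element of [T] with prescribed off-diagonal entries [c i] in the column
    [p].  The factors commute, but the ambient group is not abelian, whence the
    product over an explicit sequence. *)
Definition column_prod (s : seq 'I_n) (c : {ffun 'I_n -> int}) : G :=
  \prod_(i <- s | (i \in D) && (i != p)) expgz (x i p) (c i).

(** With [c p = 1], which holds for the column [p] of a matrix of [T],
    [transvect c p k e] changes the entry [k] by one. *)
Lemma column_prod_transvect s (c : {ffun 'I_n -> int}) k e :
  uniq s -> k \in s -> k \in D -> k != p -> c p = 1%R ->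
  column_prod s (transvect c p k e) = column_prod s c * X k p e.
Proof.
move=> us ks kD kp; have pk : p != k by rewrite eq_sym.
suff plus (d : {ffun 'I_n -> int}) : d p = 1%R ->
    column_prod s (transvect d p k false) = column_prod s d * x k p.
  move=> cp; case: e => /=; last exact: plus.
  have E := @plus (transvect c p k true).
  rewrite ffunE (negPf pk) -[false]/(~~ true) transvectK // in E.
  by rewrite E // mulgK.
elim: s us ks => // i s IH /= /andP[i_s us] + dp.
have comm_x j : j != p -> commute (x k p) (expgz (x j p) (d j)).
  by move=> jp; apply: commute_expgz; apply: (steinberg_commute sx); rewrite // eq_sym.
rewrite inE /column_prod !big_cons => /orP[/eqP eki|ks].
  rewrite -{}eki in i_s *; rewrite kD kp /= ffunE eqxx dp expgzS -!mulgA; congr (_ * _).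
  have -> : \prod_(i <- s | (i \in D) && (i != p)) expgz (x i p) (d i) * x k p
     = x k p * \prod_(i <- s | (i \in D) && (i != p)) expgz (x i p) (d i).
    apply: commute_sym.
    elim/big_ind: _ => [||j /andP[_ jp]]; [exact: commute1|exact: commuteM|].
    exact: comm_x.
  congr (_ * _); rewrite [LHS]big_seq_cond [RHS]big_seq_cond; apply: eq_bigr => j /andP[js _].
  by rewrite ffunE; case: eqP => // ejk; rewrite -ejk js in i_s.
have ik : i != k by apply: contraNneq i_s => ->.
case: ifP => _; last exact: IH.
by rewrite ffunE (negPf ik) -mulgA; congr (_ * _); apply: IH.
Qed.

Lemma column_commute t k : T t -> k \in D -> k != p -> commute t (x k p).
Proof.
move=> Tt kD kp; apply: commute_sym.
have c i : i != p -> commute (x k p) (x i p).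
  by move=> ip; apply: (steinberg_commute sx); rewrite // eq_sym.
elim: Tt => [|h s _ IH [i [_ ip ->]]|h s _ IH [i [_ ip ->]]].
- exact: commute1.
- by apply: commuteM => //; apply: c.
- by apply: commuteM => //; apply/commuteV/c.
Qed.

(** Left multiplication by [x_kp] acts on columns by a transvection, and in the
    abelian group [T] it agrees with right multiplication. *)
Lemma column_prod_col t : T t ->
  col_vec (f t) p p = 1%R /\
  t = column_prod (index_enum 'I_n) (col_vec (f t) p).
Proof.
have step h k e : T h -> k \in D -> k != p ->
    col_vec (f h) p p = 1%R /\ h = column_prod (index_enum 'I_n) (col_vec (f h) p) ->
    col_vec (f (h * X k p e)) p p = 1%R /\
    h * X k p e = column_prod (index_enum 'I_n) (col_vec (f (h * X k p e)) p).
  move=> Th kD kp [hp Eh].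
  have -> : f (h * X k p e) = f (X k p e) * f h.
    rewrite -gmulfM; congr (f _); case: e => /=; last exact: column_commute.
    by apply: commuteV; apply: column_commute.
  rewrite col_vecX // column_prod_transvect ?index_enum_uniq ?mem_index_enum // -Eh.
  by split=> //; rewrite ffunE eq_sym (negPf kp).
elim=> [|h s Th IH [k [kD kp ->]]|h s Th IH [k [kD kp ->]]].
- rewrite gmulf1; split; first by rewrite ffunE mxE eqxx.
  rewrite /column_prod big1 // => i /andP[_ ip].
  by rewrite ffunE mxE (negPf ip).
- exact: (step _ _ false).
- exact: (step _ _ true).
Qed.

(** In the factorization [g = h * t], the matrix of [t] is the inverse of that
    of [h], so its column [p] is that of the identity matrix; this forces
    [t = 1]. *)
Lemma stabilizer_ker g :
  generated_by (stabilizer_gen x D p) g -> f g = 1 ->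
  generated_by (subsystem x (D :\ p)) g.
Proof.
move=> /stabilizer_factor[h [t [Hh Tt ->]]]; rewrite gmulfM => /eqP.
rewrite mulg_eq1 => /eqP fht; have [_ ->] := column_prod_col Tt.
have -> : column_prod (index_enum 'I_n) (col_vec (f t) p) = 1; last by rewrite mulg1.
rewrite -[f t]invgK -fht -gmulfV.
have sV := supported_f (generatedV Hh).
rewrite /column_prod big1 // => i /andP[_ ip].
by rewrite ffunE sV ?(negPf ip) // !inE eqxx orbT.
Qed.

End Kernel.

(** Deleting one index of [D] at a time. *)
Theorem subsystem_ker (D : {set 'I_n}) g :
  generated_by (subsystem x D) g -> f g = 1 -> g = 1.
Proof.
move: {2}#|D| (leqnn #|D|) => m; elim: m D => [|m IH] D leD Dg fg.
  have D0 : D = set0 by apply/eqP; rewrite -cards_eq0 -leqn0.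
  case: Dg => [//|h s _ [i [j []]]|h s _ [i [j []]]]; by rewrite D0 inE.
have [D0|[p pD]] := set_0Vmem D.
  by apply: (IH D) => //; rewrite D0 cards0.
rewrite (cardsD1 p) pD in leD; apply: (IH (D :\ p)) => //.
apply: (stabilizer_ker pD _ fg).
by apply: (subsystem_fixing pD); rewrite // fg row_vec1.
Qed.

Lemma supportedXl E (A : SL) i j e : supported E A -> i \in E -> j \in E -> i != j ->
  supported E (f (X i j e) * A).
Proof.
move=> sA iE jE ij q k qk; have /ffunP/(_ q) := col_vecX A k e ij.
rewrite !ffunE => ->; have [eqi|qi] := eqVneq q i; last exact: sA.
rewrite eqi iE /= in qk; rewrite eqi !sA ?qk ?orbT //.
have [-> ->] : (i == k) = false /\ (j == k) = false; last by case: e.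
by split; apply: contraNF qk => /eqP <-.
Qed.

Lemma subsystemX (D : {set 'I_n}) i j e : i \in D -> j \in D -> i != j ->
  generated_by (subsystem x D) (X i j e).
Proof.
move=> iD jD ij; have Dx : generated_by (subsystem x D) (x i j).
  by apply: generated_gen; exists i, j.
by case: e => //=; apply: generatedV.
Qed.

Lemma subsystemw (D : {set 'I_n}) i j : i \in D -> j \in D -> i != j ->
  generated_by (subsystem x D) (w i j).
Proof.
move=> iD jD ij; have ji : j != i by rewrite eq_sym.
by do !apply: generatedM; [apply: (@subsystemX _ i j false)|
  apply: (@subsystemX _ j i true)|apply: (@subsystemX _ i j false)].
Qed.

Lemma row_nonzero (A : SL) p : exists k, row_vec A p k != 0%R.
Proof.
apply/existsP; apply: contraT; rewrite negb_exists => /forallP A0.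
have : slval (A * A^-1) p p = 1%R by rewrite mulgV mxE eqxx.
rewrite slvalM mxE big1 // => k _.
by have := A0 k; rewrite ffunE negbK => /eqP ->; rewrite mul0r.
Qed.

(** The nonzero entry divides the entry [p, p] of [A * A^-1], which is 1. *)
Lemma row_unit (A : SL) p k : (forall j, j != k -> row_vec A p j = 0%R) ->
  exists e, row_vec A p = signed_unit k e.
Proof.
move=> A0; have : slval (A * A^-1) p p = 1%R by rewrite mulgV mxE eqxx.
rewrite slvalM mxE (bigD1 k) //= big1 => [|j jk]; last first.
  by have := A0 j jk; rewrite ffunE => ->; rewrite mul0r.
rewrite addr0 => /(congr1 absz); rewrite abszM => /eqP.
rewrite muln_eq1 => /andP[/eqP Apk _]; exists (slval A p k < 0)%R.
apply/ffunP => j; rewrite [RHS]ffunE; have [->|/A0//] := eqVneq j k.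
by rewrite ffunE; move: Apk; case: (boolP (_ < _)%R) => /=; lia.
Qed.

(** Of two nonzero entries of the row, the smaller one reduces the other.  When
    a single entry is left it is 1 or -1, and Weyl elements bring it to the
    place [p] with the right sign. *)
Lemma row_clear (D : {set 'I_n}) p (A : SL) : p \in D -> supported D A ->
  exists2 g, generated_by (subsystem x D) g &
             row_vec (A * f g) p = signed_unit p false.
Proof.
move=> pD; move: {2}(l1norm (row_vec A p)) (leqnn (l1norm (row_vec A p))) => N.
elim: N A => [|N IH] A; set v := row_vec A p => leN sA.
  have [k] := row_nonzero A p; move: leN; rewrite leqn0 sum_nat_eq0.
  by move=> /forallP/(_ k)/=; rewrite absz_eq0 -/v => ->.
have vD k : v k != 0%R -> k \in D.
  apply: contraNT => kD; rewrite ffunE sA ?kD ?orbT //.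
  by have [epk|//] := eqVneq p k; rewrite -epk pD in kD.
have [k vk] := row_nonzero A p; have kD := vD _ vk.
have [/existsP[j /andP[jk vj]]|] := boolP [exists j, (j != k) && (v j != 0%R)].
  have jD := vD _ vj.
  have [i' [j' [i'D j'D ij' [e re]]]] : exists i j, [/\ i \in D, j \in D, i != j &
      exists e, reduces v i j e].
    have [le|lt] := leqP `|v j| `|v k|.
      by exists j, k; split=> //; apply: signed_reduce_exists.
    exists k, j; split; rewrite // 1?eq_sym //.
    by apply: signed_reduce_exists => //; apply: ltnW.
  have [||g Dg row_g] := IH (A * f (X i' j' e)).
  - rewrite row_vecX // -/v; rewrite reducesP // in re.
    by rewrite -ltnS; apply: leq_trans re leN.
  - exact: supportedX.
  exists (X i' j' e * g); last by rewrite gmulfM mulgA.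
  by apply: generatedM => //; apply: subsystemX.
rewrite negb_exists => /forallP v0.
have [j jk|e Ev] := @row_unit A p k.
  by have := v0 j; rewrite jk negbK => /eqP.
have move_w a b (B : SL) s : a != b -> row_vec B p = signed_unit a s ->
    row_vec (B * f (w a b)) p = signed_unit b s.
  by move=> ab EB; rewrite row_vec_w // EB weyl_swap_unit tpermL (negPf ab) addbF.
have moveN_w a b (B : SL) s : a != b -> row_vec B p = signed_unit a s ->
    row_vec (B * f (w b a)) p = signed_unit b (~~ s).
  by move=> ab EB; rewrite row_vec_w 1?eq_sym // EB weyl_swap_unit tpermR eqxx addbT.
(* Each Weyl element below is chosen so that the sign comes out positive. *)
have [ekp|kp] := eqVneq k p; last first.
  have pk : p != k by rewrite eq_sym.
  case: e Ev => Ev.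
    exists (w p k); first exact: subsystemw.
    by rewrite (moveN_w k p A true).
  exists (w k p); first exact: subsystemw.
  by rewrite (move_w k p A false).
rewrite {}ekp in Ev; case: e Ev => Ev; last first.
  by exists 1; [exact: generated1|rewrite gmulf1 mulg1].
have [/existsP[q /andP[qD qp]]|] := boolP [exists q, (q \in D) && (q != p)].
  have pq : p != q by rewrite eq_sym.
  (* The vector - e_p goes to - e_q, then to e_p. *)
  exists (w p q * w p q).
    by apply: generatedM; apply: subsystemw.
  by rewrite gmulfM mulgA (moveN_w q p _ true) // (move_w p q A true).
(* If p is the only index in D, then A is diagonal and its determinant is A p p. *)
rewrite negb_exists => /forallP Dp.
have D1 q : q != p -> q \notin D by move=> qp; have := Dp q; rewrite qp andbT.
have Atrig : is_trig_mx (slval A).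
  apply/is_trig_mxP => i j ij; rewrite sA; first by rewrite -val_eqE /= (ltn_eqF ij).
  have [eip|/D1 ->//] := eqVneq i p; rewrite -eip in D1; rewrite orbC D1 //.
  by rewrite -val_eqE /= gtn_eqF.
have := det_slval A; rewrite (det_trig Atrig) (bigD1 p) //= big1 => [|i ip]; last first.
  by rewrite sA ?eqxx ?D1.
by move/ffunP/(_ p): Ev; rewrite !ffunE eqxx mulr1 => ->.
Qed.

(** The entry of the column at the place [p] is 1 and reduces any other nonzero
    entry of the column; left multiplication by [x_ip] leaves the row [p]
    unchanged. *)
Lemma column_clear (D : {set 'I_n}) p (A : SL) : p \in D -> supported D A ->
  row_vec A p = signed_unit p false ->
  exists2 g, generated_by (subsystem x D) g & supported (D :\ p) (f g * A).
Proof.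
move=> pD; move: {2}(l1norm (col_vec A p)) (leqnn (l1norm (col_vec A p))) => N.
elim: N A => [|N IH] A; set c := col_vec A p => leN sA row_A;
  have cp : c p = 1%R by move/ffunP/(_ p): row_A; rewrite !ffunE eqxx.
  by move: leN; rewrite leqn0 sum_nat_eq0 => /forallP/(_ p)/=; rewrite -/c cp.
have [/existsP[i /andP[ip ci]]|] := boolP [exists i, (i != p) && (c i != 0%R)]; last first.
  rewrite negb_exists => /forallP c0; exists 1; first exact: generated1.
  rewrite gmulf1 mul1g => i j; rewrite !inE !negb_and !negbK -!orbA.
  have [-> _|ip /=] := eqVneq i p.
    by move/ffunP/(_ j): row_A; rewrite !ffunE eq_sym => ->; case: eqP.
  have [-> _|jp /=] := eqVneq j p; last exact: sA.
  by rewrite (negPf ip); have := c0 i; rewrite ip ffunE negbK => /eqP.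
have iD : i \in D.
  by apply: contraNT ci => iD; rewrite ffunE sA ?iD // (negPf ip).
have [||e re] := @signed_reduce_exists (c p) (c i); rewrite ?cp //.
  by move: ci; clear; lia.
have pi : p != i by rewrite eq_sym.
have [|||g Dg sg] := IH (f (X i p e) * A).
- rewrite col_vecX // -/c -ltnS; apply: leq_trans leN.
  by rewrite -reducesP.
- exact: supportedXl.
- rewrite -row_A; apply/ffunP => k; have /ffunP/(_ p) := col_vecX A k e ip.
  by rewrite !ffunE (negPf pi).
exists (g * X i p e); last by rewrite gmulfM -mulgA.
by apply: generatedM => //; apply: subsystemX.
Qed.

Theorem supported_generated (D : {set 'I_n}) (A : SL) : supported D A ->
  exists2 g, generated_by (subsystem x D) g & f g = A.
Proof.
move: {2}#|D| (leqnn #|D|) => m; elim: m D A => [|m IH] D A leD sA.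
  have D0 : D = set0 by apply/eqP; rewrite -cards_eq0 -leqn0.
  exists 1; first exact: generated1.
  by rewrite gmulf1; apply/val_inj/matrixP => i j; rewrite mxE [RHS]sA // D0 inE.
have [D0|[p pD]] := set_0Vmem D.
  by apply: IH; rewrite // D0 cards0.
rewrite (cardsD1 p) pD in leD.
have [g Dg row_g] := row_clear pD sA.
have sAg : supported D (A * f g).
  elim: Dg {row_g} => [|h s _ IHh [i [j [iD jD ij ->]]]|h s _ IHh [i [j [iD jD ij ->]]]].
  - by rewrite gmulf1 mulg1.
  - by rewrite gmulfM mulgA; apply: (@supportedX _ _ i j false).
  - by rewrite gmulfM mulgA; apply: (@supportedX _ _ i j true).
have [t Dt st] := column_clear pD sAg row_g.
have [h Dh fh] := IH _ _ leD st.
have sub r : generated_by (subsystem x (D :\ p)) r -> generated_by (subsystem x D) r.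
  apply: generated_sub => s [i [j [iD jD ij ->]]]; apply: generated_gen.
  by exists i, j; move: iD jD; rewrite !inE => /andP[_ iD] /andP[_ jD].
exists (t^-1 * h * g^-1).
  by apply: generatedM; [apply: generatedM|]; try exact: generatedV; exact: sub.
by rewrite !gmulfM !gmulfV fh !mulgA mulVg mul1g mulgK.
Qed.

End Realisation.

(** * Morphisms from free and presented groups *)

Section FreeGroupLift.
Variables (X : choiceType) (H : groupType) (h : X -> H).
Local Open Scope group_scope.

Definition word_eval (u : word X) : H :=
  \prod_(l <- u) (if l.2 then h l.1 else (h l.1)^-1).

Lemma word_eval_eq u v : word_eq u v -> word_eval u = word_eval v.
Proof.
elim=> {u v} [//|//|u v t _ -> _ ->//|u v y e].
rewrite /word_eval !big_cat !big_cons big_nil /=; congr (_ * _).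
by case: e; rewrite /= mulg1 ?mulgV ?mulVg mul1g.
Qed.

Definition free_lift (g : freeGroup X) : H := word_eval (repr g).

Lemma free_lift_class u : free_lift (fg_class u) = word_eval u.
Proof. exact/word_eval_eq/word_eq_repr. Qed.

Lemma fg_class_mul u v : fg_class (u ++ v) = fg_class u * fg_class v :> freeGroup X.
Proof. by rewrite -fg_classM. Qed.

Lemma free_lift_morphism : monoid.monoid_morphism free_lift.
Proof.
split; first by rewrite free_lift_class /word_eval big_nil.
move=> g g'; rewrite -[g]fg_classK -[g']fg_classK -fg_class_mul !free_lift_class.
by rewrite /word_eval big_cat.
Qed.

HB.instance Definition _ :=
  monoid.isUMagmaMorphism.Build (freeGroup X) H free_lift free_lift_morphism.

Lemma free_lift_gen y : free_lift (fgen y) = h y.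
Proof. by rewrite free_lift_class /word_eval big_seq1. Qed.

End FreeGroupLift.

Lemma freeGroup_generated (X : choiceType) (g : freeGroup X) :
  generated_by (fun s => exists y : X, s = fgen y) g.
Proof.
rewrite -[g]fg_classK; elim: (repr g) => [|[y e] u IH]; first exact: generated1.
rewrite -cat1s fg_class_mul; apply: generatedM => //.
have Sy : generated_by (fun s => exists y : X, s = fgen y) (fgen y).
  by apply: generated_gen; exists y.
case: e => //; have -> : fg_class [:: (y, false)] = (fgen y)^-1%g;
  last exact: generatedV.
by rewrite /fgen -[(_^-1)%g]/(fg_inv _) fg_classV.
Qed.

Section PresentedLift.
Variables (G : groupType) (R : seq G).
Local Open Scope group_scope.

Lemma pr_class_morphism : monoid.monoid_morphism (@pr_class G R).
Proof. by split=> // g g'; rewrite -pr_classM. Qed.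

HB.instance Definition _ :=
  monoid.isUMagmaMorphism.Build G (presented R) (@pr_class G R) pr_class_morphism.

Lemma pr_class_rel r : r \in R -> pr_class R r = 1.
Proof.
move=> Rr; apply/esym/eqP/pr_classP.
by rewrite invg1 mul1g; apply: normal_closure_rel.
Qed.

Variables (H : groupType) (phi : UMagmaMorphism.type G H).

(** The proof that [phi] kills the relators is an argument, so that the
    morphism structure declared below can be inferred from the term. *)
Definition presented_lift (_ : forall r, r \in R -> phi r = 1) (q : presented R) : H :=
  phi (repr q).

Hypothesis phiR : forall r, r \in R -> phi r = 1.

Lemma presented_lift_class g : presented_lift phiR (pr_class R g) = phi g.
Proof.
have kills r : normal_closure R r -> phi r = 1.
  elim=> {r} [r /phiR//||g1 g2 _ e1 _ e2|g1 _ e1|g1 g2 _ e1].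
  - exact: gmulf1.
  - by rewrite gmulfM e1 e2 mulg1.
  - by rewrite gmulfV e1 invg1.
  - by rewrite gmulfJ e1 conj1g.
apply: (mulgI (phi (repr (pr_class R g)))^-1).
by rewrite mulVg -gmulfV -gmulfM kills //; apply: nc_repr.
Qed.

Lemma presented_lift_morphism : monoid.monoid_morphism (presented_lift phiR).
Proof.
split; first by rewrite presented_lift_class gmulf1.
move=> q q'; rewrite -[q]pr_classK -[q']pr_classK -gmulfM.
by rewrite !presented_lift_class gmulfM.
Qed.

HB.instance Definition _ :=
  monoid.isUMagmaMorphism.Build (presented R) H (presented_lift phiR)
    presented_lift_morphism.

End PresentedLift.

(** * The relators *)

Section WordsMorphism.
Variables (G H : groupType) (phi : UMagmaMorphism.type G H) (n : nat) (a b : G).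
Local Open Scope group_scope.

Lemma conj_pow_morph k : phi (conj_pow a b k) = conj_pow (phi a) (phi b) k.
Proof. by rewrite /conj_pow !gmulfM gmulfV !gmulfXn. Qed.

Lemma tau_low_morph d j : phi (tau_low a b d j) = tau_low (phi a) (phi b) d j.
Proof.
elim: d j => [|[|d] IH] j; first exact: gmulf1; first exact: conj_pow_morph.
by rewrite [LHS]gmulfR IH conj_pow_morph.
Qed.

Lemma tau_morph i j : phi (tau n a b i j) = tau n (phi a) (phi b) i j.
Proof.
have tau_1n_morph : phi (tau_1n n a b) = tau_1n n (phi a) (phi b).
  by rewrite /tau_1n /expg_eps; case: ifP; rewrite ?gmulfV conj_pow_morph.
have tau_col_morph k : phi (tau_col n a b k) = tau_col n (phi a) (phi b) k.
  by rewrite /tau_col; case: ifP; rewrite ?gmulfR ?tau_low_morph tau_1n_morph.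
rewrite /tau; case: ifP => _; first exact: gmulf1.
case: ifP => _; first exact: tau_low_morph.
by case: ifP => _; rewrite ?gmulfR ?tau_low_morph tau_col_morph.
Qed.

Lemma weyl_morph i j : phi (weyl n a b i j) = weyl n (phi a) (phi b) i j.
Proof. by rewrite /weyl !gmulfM gmulfV !tau_morph. Qed.

Lemma relators_morph : [seq phi r | r <- relators n a b] = relators n (phi a) (phi b).
Proof.
rewrite /relators !map_cat /relators_comm /relators_steinberg !map_allpairs /=.
congr (_ ++ (_ ++ _)).
- by apply: eq_allpairs => p q; rewrite gmulfR !tau_morph.
- by apply: eq_allpairs => p k; rewrite gmulfF gmulfR !tau_morph.
- rewrite gmulfXn gmulfF gmulf_prod weyl_morph.
  by congr [:: _; _ / _]; apply: eq_bigr => r _; rewrite weyl_morph.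
Qed.

End WordsMorphism.

Section Relations.
Variables (G : groupType) (n : nat) (a b : G).
Local Open Scope group_scope.
Local Notation tau := (tau n a b).

Record presentation_relations : Prop := PresentationRelations {
  tau_comm : forall i j k l, i \in indices n -> j \in indices n ->
    k \in indices n -> l \in indices n -> i != j -> k != l ->
    i != l -> j != k -> [~ tau i j, tau k l] = 1;
  tau_commutator : forall i j k, i \in indices n -> j \in indices n ->
    k \in indices n -> i != j -> j != k -> i != k ->
    [~ tau i j, tau j k] = tau i k;
  weyl_order4 : weyl n a b 1 2 ^+ 4 = 1;
  prod_weyl : a = \prod_(r <- rev (index_iota 1 n)) weyl n a b r r.+1
}.

Lemma mem_offdiag i j :
  ((i, j) \in offdiag n) = [&& i != j, i \in indices n & j \in indices n].
Proof.
rewrite mem_filter /=; congr (_ && _).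
apply/allpairsP/andP => [[[i' j'] [/= ii jj [-> ->]]]|[ii jj]] //.
by exists (i, j).
Qed.

Lemma relatorsP : (forall r, r \in relators n a b -> r = 1) <-> presentation_relations.
Proof.
split=> [rel|[cc cs w4 pw] r].
  split.
  - move=> i j k l ii jj kk ll ij kl il jk.
    have [/eqP[-> ->]|pq] := boolP ((i, j) == (k, l)); first exact: commgg.
    apply: rel; rewrite mem_cat; apply/orP; left.
    apply/allpairsPdep; exists (i, j), (k, l); split=> //=;
      first by rewrite mem_offdiag ij ii.
    by rewrite mem_filter /= pq il jk mem_offdiag kl kk.
  - move=> i j k ii jj kk ij jk ik; apply/divg1_eq/rel.
    rewrite !mem_cat; apply/orP; right; apply/orP; left.
    apply/allpairsPdep; exists (i, j), k; split=> //=;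
      first by rewrite mem_offdiag ij ii.
    by rewrite mem_filter /= kk !(eq_sym k) ik jk.
  - by apply: rel; rewrite !mem_cat inE eqxx !orbT.
  - by apply/divg1_eq/rel; rewrite !mem_cat !inE eqxx !orbT.
rewrite !mem_cat !inE => /or4P[].
- move=> /allpairsPdep[[i j] [[k l] [/= ij]]]; rewrite mem_filter /=.
  move=> /andP[/and3P[_ il jk] kl] ->.
  by move: ij kl; rewrite !mem_offdiag => /and3P[ij ii jj] /and3P[kl kk ll]; apply: cc.
- move=> /allpairsPdep[[i j] [k [/= ij]]]; rewrite mem_filter /=.
  move=> /andP[/andP[ki kj] kk] ->.
  move: ij; rewrite mem_offdiag => /and3P[ij ii jj].
  by rewrite cs ?mulgV // eq_sym.
- by move=> /eqP ->.
- by move=> /eqP ->; rewrite -pw mulgV.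
Qed.

End Relations.

(** * Elementary matrices *)

Section Elementary.
Variable n : nat.
Local Open Scope ring_scope.
Local Notation SL := (specialLinear int n).
Implicit Types i j k l : 'I_n.

Definition elementary_mx i j : 'M[int]_n :=
  1%:M + (if i == j then 0 else delta_mx i j).

Lemma det_elementary_mx i j : \det (elementary_mx i j) == 1.
Proof.
rewrite /elementary_mx; have [_|ij] := eqVneq i j; first by rewrite addr0 det1.
wlog ji : i j ij / (j < i)%N => [Hw|].
  have [ji|] := ltnP j i; first exact: Hw.
  rewrite leq_eqVlt val_eqE (negPf ij) /= => {}ij'.
  by rewrite -det_tr linearD /= trmx1 trmx_delta; apply: Hw; rewrite // eq_sym.
have trig : is_trig_mx (1%:M + delta_mx i j : 'M[int]_n).
  apply/is_trig_mxP => k l kl; rewrite !mxE -val_eqE /= ltn_eqF //.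
  by case: andP => // -[/eqP ki /eqP lj]; move: kl; rewrite ki lj ltnNge ltnW.
rewrite (det_trig trig) big1 // => k _; rewrite !mxE eqxx.
by case: andP => // -[/eqP ki /eqP kj]; rewrite -ki -kj eqxx in ij.
Qed.

Definition elementary i j : SL := SpecialLinear (det_elementary_mx i j).

Lemma elementaryE i j : i != j -> slval (elementary i j) = 1%:M + delta_mx i j.
Proof. by rewrite /= /elementary_mx => /negPf ->. Qed.

Lemma elementary_steinberg : (2 < n)%N -> steinberg_system elementary.
Proof.
move=> n3; split.
- move=> i j k l ij kl il jk; apply/val_inj.
  change (slval (elementary i j) *m slval (elementary k l) =
          slval (elementary k l) *m slval (elementary i j)).
  rewrite !elementaryE //.
  have li : l != i by rewrite eq_sym.
  rewrite !mulmxDr !mulmxDl !mulmx1 !mul1mx !mul_delta_mx_0 //.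
  by rewrite !addr0 -!addrA; congr (_ + _); rewrite addrC.
- move=> i j k ij jk ik; apply: (mulgI (elementary j k * elementary i j))%g.
  rewrite -commgC; apply/val_inj.
  change (slval (elementary i j) *m slval (elementary j k) =
    slval (elementary j k) *m slval (elementary i j) *m slval (elementary i k)).
  rewrite !elementaryE //.
  have [ki ji] : k != i /\ j != i by split; rewrite eq_sym.
  rewrite !mulmxDr !mulmxDl !mulmx1 !mul1mx mul_delta_mx !mul_delta_mx_0 //.
  by rewrite !mul0mx !addr0 -!addrA; congr (_ + _); rewrite addrCA.
- move=> i j; have /card_gt0P[k] : (0 < #|~: [set i; j]|)%N.
    by rewrite cardsCs setCK card_ord cards2; case: (i != j) => /=; lia.
  by rewrite !inE negb_or => kij; exists k.
Qed.

Lemma row_vec_inj (A B : SL) : (forall p, row_vec A p = row_vec B p) -> A = B.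
Proof.
move=> AB; apply/val_inj/matrixP => i j.
by have /ffunP/(_ j) := AB i; rewrite !ffunE.
Qed.

Lemma row_vec_elementary_w (A : SL) p i j : i != j ->
  row_vec (A * weyl_elt elementary i j)%g p = weyl_swap (row_vec A p) i j.
Proof.
pose idSL : monoid.UMagmaMorphism.type SL SL := @idfun SL.
exact: (@row_vec_w n SL elementary idSL elementaryE A p i j).
Qed.

Lemma elementary_w_order4 i j : i != j -> (weyl_elt elementary i j ^+ 4 = 1)%g.
Proof.
move=> ij; have ji : j != i by rewrite eq_sym.
have exp4 (g : SL) : (g ^+ 4 = 1 * g * g * g * g)%g.
  by rewrite mul1g !expgS expg0 mulg1 !mulgA.
apply: row_vec_inj => p; rewrite exp4 !row_vec_elementary_w //.
apply/ffunP => k; rewrite !ffunE !tpermK.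
have [->|ki] := eqVneq k i; first by rewrite tpermL (negPf ji) /= opprK.
have [->|kj] := eqVneq k j; first by rewrite tpermR eqxx /= opprK.
by have [ik jk] : i != k /\ j != k; [split; rewrite eq_sym | rewrite tpermD // (negPf ki)].
Qed.

End Elementary.

Lemma conj_powS (G : groupType) (a b : G) k :
  (conj_pow a b k.+1 = conj_pow a b k ^ a)%g.
Proof. by rewrite /conj_pow conjgE expgSr invgM !mulgA. Qed.

Section Monomial.
Variable n : nat.
Local Notation SL := (specialLinear int n).
Local Open Scope group_scope.

Lemma row_vec_elementary_mul (A : SL) (i j p : 'I_n) : i != j ->
  row_vec (elementary i j * A) p =
  [ffun q => if p == i then (slval A i q + slval A j q)%R else slval A p q].
Proof.
move=> ij; pose idSL : monoid.UMagmaMorphism.type SL SL := @idfun SL.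
apply/ffunP => q; rewrite !ffunE.
have /ffunP/(_ p) := @col_vecX n SL (@elementary n) idSL (@elementaryE n) A q i j false ij.
by rewrite !ffunE => ->; have [_|_] := eqVneq p i.
Qed.

(** [A] is a signed permutation matrix, so conjugation by it permutes the matrix
    units up to sign. *)
Lemma conj_monomial (A : SL) (sigma : 'I_n -> 'I_n) (s : 'I_n -> bool) i j :
  injective sigma -> (forall p, row_vec A p = signed_unit (sigma p) (s p)) ->
  i != j ->
  elementary i j ^ A = signed_gen (@elementary n) (sigma i) (sigma j) (s i (+) s j).
Proof.
move=> inj_sigma rowA ij; have sij : sigma i != sigma j by rewrite (inj_eq inj_sigma).
pose idSL : monoid.UMagmaMorphism.type SL SL := @idfun SL.
apply: (mulgI A); rewrite -conjgC; apply: row_vec_inj => p.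
rewrite row_vec_elementary_mul // (@row_vecX n SL _ idSL (@elementaryE n)) //.
have entry q k : slval A q k = if k == sigma q then signed (s q) 1%R else 0%R.
  by have /ffunP/(_ k) := rowA q; rewrite !ffunE.
apply/ffunP => q; rewrite rowA !ffunE !entry !(inj_eq inj_sigma) (eq_sym i).
have [->|_] := eqVneq p i; last first.
  have [->|_] := eqVneq q (sigma j); rewrite ?(inj_eq inj_sigma) //.
  by case: (_ (+) _); rewrite /= ?oppr0 addr0.
rewrite eq_sym in ij; rewrite (negPf ij).
have [->|_] := eqVneq q (sigma j); last by rewrite addr0.
by rewrite (inj_eq inj_sigma) (negPf ij) !add0r; case: (s i); case: (s j).
Qed.

End Monomial.

(** * The words evaluated at the two matrices *)

Section CycleMatrix.
Variable N : nat.
Local Notation n := N.+3.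
Local Notation SL := (specialLinear int n).
Local Open Scope group_scope.

(** Words are indexed from 1, matrices from 0. *)
Definition ord_of (i : nat) : 'I_n := inord i.-1.

Lemma ord_of_val i : i \in indices n -> ord_of i = i.-1 :> nat.
Proof. by rewrite mem_index_iota => /andP[i0 ilt]; rewrite /ord_of /= inordK //; lia. Qed.

Lemma ord_of_eq i j : i \in indices n -> j \in indices n ->
  (ord_of i == ord_of j) = (i == j).
Proof.
move=> ii jj; rewrite -val_eqE /= !ord_of_val //.
by move: ii jj; rewrite !mem_index_iota; lia.
Qed.

Lemma mem_indices (i : 'I_n) : i.+1 \in indices n.
Proof. by rewrite mem_index_iota ltnS; exact: (ltn_ord i). Qed.

Lemma ord_ofS (i : 'I_n) : ord_of i.+1 = i.
Proof. by rewrite /ord_of inord_val. Qed.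

Definition elem (i j : nat) : SL := elementary (ord_of i) (ord_of j).

(** The matrix [a_n], built as the product in the last relator; this makes its
    determinant one by construction. *)
Definition cycle_sl : SL :=
  \prod_(r <- rev (index_iota 1 n)) weyl_elt (@elementary n) (ord_of r) (ord_of r.+1).

(** Reading the product from left to right, the factor with indices [r, r.+1]
    sends [e_r], untouched so far, to its final place [e_(r.+1)], and moves the
    image of [e_n] from the place [r.+1] to the place [r], changing its sign. *)
Lemma row_vec_cycle_partial k p : k \in indices n -> p \in indices n ->
  row_vec (\prod_(r <- rev (index_iota k n))
             weyl_elt (@elementary n) (ord_of r) (ord_of r.+1)) (ord_of p) =
  if (p < k)%N then signed_unit (ord_of p) false
  else if (p < n)%N then signed_unit (ord_of p.+1) false
  else signed_unit (ord_of k) (odd (n - k)).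
Proof.
rewrite !mem_index_iota => /andP[k0 kn] /andP[p0 pn].
have : (k <= n)%N by lia.
move Em: (n - k)%N => m; elim: m k k0 kn Em => [|m IH] k k0 kn Em k_le.
  have -> : k = n by lia.
  rewrite /index_iota subnn big_nil row_vec1.
  by case: ltnP => // ?; have -> : p = n by lia.
have kn' : (k < n)%N by lia.
have -> : index_iota k n = k :: index_iota k.+1 n.
  by rewrite /index_iota -{1}(subnSK kn').
rewrite rev_cons big_rcons row_vec_elementary_w; last first.
  by rewrite ord_of_eq ?mem_index_iota; lia.
rewrite IH //; try lia.
have oE i j : (0 < i < n.+1)%N -> (0 < j < n.+1)%N -> (ord_of i == ord_of j) = (i == j).
  by move=> *; rewrite ord_of_eq // mem_index_iota.
have tD i : (0 < i < n.+1)%N -> i != k -> i != k.+1 ->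
    tperm (ord_of k) (ord_of k.+1) (ord_of i) = ord_of i.
  by move=> ii ik iSk; rewrite tpermD // oE 1?eq_sym //; lia.
have [pk|kp] := ltnP p k.
  rewrite (leqW pk) weyl_swap_unit oE ?tD; try lia.
  by have -> : (p == k.+1) = false by lia.
have [pk|kp'] := ltnP p k.+1.
  have -> : p = k by lia.
  by rewrite kn' weyl_swap_unit tpermL oE; try lia; have -> : (k == k.+1) = false by lia.
have [pn'|np] := ltnP p n.
  rewrite weyl_swap_unit oE ?tD; try lia.
  by have -> : (p.+1 == k.+1) = false by lia.
by rewrite weyl_swap_unit tpermR eqxx addbT.
Qed.

(** The sign of the only nonzero entry in the row [i] of [a_n]. *)
Definition wrap (i : 'I_n) : bool := (i.+1 == n) && odd n.-1.

Lemma row_vec_cycle (i : 'I_n) : row_vec cycle_sl i = signed_unit (ordS i) (wrap i).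
Proof.
rewrite -{1}(ord_ofS i) row_vec_cycle_partial ?mem_indices //.
rewrite ltnS ltn0 /wrap; have [ei|ni] := eqVneq i.+1 n.
  rewrite ei ltnn /=; congr (signed_unit _ _).
  by apply: val_inj; rewrite /= ord_of_val //= ei modnn.
have lt_i : (i.+1 < n)%N by rewrite ltn_neqAle ni; exact: (ltn_ord i).
rewrite lt_i; congr (signed_unit _ _).
by apply: val_inj; rewrite /= ord_of_val ?mem_index_iota ?modn_small //= ltnS ltnW.
Qed.

Lemma eps_signed : eps n = signed (odd n.-1) 1.
Proof. by rewrite /eps -signr_odd; case: odd. Qed.

Lemma cycle_slE : slval cycle_sl = a_mx n.
Proof.
apply/matrixP => i j; have /ffunP/(_ j) := row_vec_cycle i.
rewrite !ffunE => ->; rewrite /a_mx !mxE summxE -val_eqE /=.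
under eq_bigr do rewrite mxE.
rewrite /wrap; have [ei|ni] /= := eqVneq i.+1 n.
  rewrite big_nat big1 ?add0r => [|k /andP[_ kn]]; last by rewrite ei gtn_eqF.
  by rewrite ei modnn eqSS eps_signed; case: eqP => _; rewrite ?mulr0 ?mulr1.
have iltn : (i.+1 < n)%N by rewrite ltn_neqAle ni ltn_ord.
rewrite mulr0 addr0 (bigD1_seq i.+1) ?mem_index_iota ?iota_uniq //=.
rewrite big1 => [|k ki]; last first.
  by rewrite eq_sym (negPf ki).
by rewrite eqxx /= eqSS addr0 modn_small //; case: eqP.
Qed.

Lemma elem_b : slval (elem 2 1) = b_mx n.
Proof.
rewrite elementaryE ?ord_of_eq //; congr (_ + _)%R.
by apply/matrixP => i j; rewrite !mxE -!val_eqE /= !ord_of_val.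
Qed.

Local Notation a := cycle_sl.
Local Notation b := (elem 2 1).

Lemma elem_conj i j : i \in indices n -> j \in indices n -> i != j ->
  elem i j ^ a = signed_gen (@elementary n) (ordS (ord_of i)) (ordS (ord_of j))
    (((i == n) (+) (j == n)) && odd n.-1).
Proof.
move=> ii jj ij; have inj_ordS : injective (@ordS n) by exact: ordS_inj.
rewrite (conj_monomial inj_ordS row_vec_cycle) ?ord_of_eq //.
rewrite /wrap !ord_of_val // !prednK.
- by congr (signed_gen _ _ _ _); case: (i == n); case: (j == n); rewrite /= ?addbb ?addbF.
- by move: jj; rewrite mem_index_iota => /andP[].
- by move: ii; rewrite mem_index_iota => /andP[].
Qed.

Lemma ordS_ord_of i : (0 < i < n)%N -> ordS (ord_of i) = ord_of i.+1.
Proof.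
move=> /andP[i0 ilt]; apply: val_inj; rewrite /= !ord_of_val ?mem_index_iota; try lia.
by rewrite prednK // modn_small.
Qed.

Lemma conj_pow_elem k : (k < n.-1)%N -> conj_pow a b k = elem k.+2 k.+1.
Proof.
elim: k => [|k IH] kn; first by rewrite /conj_pow expg0 invg1 mul1g mulg1.
rewrite conj_powS IH ?(ltn_trans _ kn) // elem_conj ?mem_index_iota; try lia.
rewrite !ordS_ord_of; try lia.
by have -> : ((k.+2 == n) (+) (k.+1 == n)) = false by lia.
Qed.

(** Conjugating [1 + E_(n, n-1)] by [a_n] gives [1 + E_1n] or its inverse,
    according to the sign [eps n]; [expg_eps] compensates for that sign. *)
Lemma tau_1n_elem : tau_1n n a b = elem 1 n.
Proof.
have -> : tau_1n n a b = expg_eps n (conj_pow a b n.-2 ^ a) by rewrite -conj_powS.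
rewrite conj_pow_elem // elem_conj ?mem_index_iota; try lia.
rewrite [ordS (ord_of n.-1)]ordS_ord_of; try lia.
have -> : ordS (ord_of n.-2.+2) = ord_of 1.
  by apply: val_inj; rewrite /= !ord_of_val ?mem_index_iota //= modnn.
rewrite /expg_eps eps_signed eqxx; have -> : (n.-2.+1 == n) = false by lia.
by case: odd => //=; rewrite invgK.
Qed.

Lemma elem_steinberg i j k : i \in indices n -> j \in indices n -> k \in indices n ->
  i != j -> j != k -> i != k -> [~ elem i j, elem j k] = elem i k.
Proof.
move=> ii jj kk ij jk ik.
by apply: (steinberg_commutator (elementary_steinberg _)); rewrite ?ord_of_eq.
Qed.

Lemma tau_low_elem d j : (0 < d)%N -> (0 < j)%N -> (d + j <= n)%N ->
  tau_low a b d j = elem (d + j) j.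
Proof.
elim: d j => [//|[|d] IH] j _ j0 dj.
  by rewrite /= conj_pow_elem; [rewrite prednK|lia].
have -> : tau_low a b d.+2 j = [~ tau_low a b d.+1 j.+1, conj_pow a b j.-1] by [].
rewrite IH ?conj_pow_elem; try lia.
rewrite (prednK j0) addnS -addSn elem_steinberg ?mem_index_iota //; lia.
Qed.

Lemma tau_elem i j : i \in indices n -> j \in indices n -> i != j ->
  tau n a b i j = elem i j.
Proof.
rewrite !mem_index_iota => ii jj ij.
have col k : (0 < k < n)%N -> tau_col n a b k = elem k n.
  move=> kn; rewrite /tau_col tau_1n_elem; have [->//|k1] := eqVneq k 1%N.
  rewrite tau_low_elem; try lia.
  by rewrite addn1 prednK ?elem_steinberg ?mem_index_iota //; lia.
rewrite /tau (negPf ij); case: ifP => ji.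
  by rewrite tau_low_elem ?subnK //; lia.
have [ejn|jn] := eqVneq j n; first by rewrite ejn col //; lia.
rewrite col ?tau_low_elem ?subnK; try lia.
by rewrite elem_steinberg ?mem_index_iota //; lia.
Qed.

Lemma weyl_elem i j : i \in indices n -> j \in indices n -> i != j ->
  weyl n a b i j = weyl_elt (@elementary n) (ord_of i) (ord_of j).
Proof. by move=> ii jj ij; rewrite /weyl !tau_elem // eq_sym. Qed.

Lemma sl_relations : presentation_relations n a b.
Proof.
split.
- move=> i j k l ii jj kk ll ij kl il jk; rewrite !tau_elem //.
  apply/eqP/commgP/(steinberg_commute (elementary_steinberg _)) => //;
  by rewrite ord_of_eq.
- by move=> i j k *; rewrite !tau_elem //; apply: elem_steinberg.
- by rewrite weyl_elem // elementary_w_order4 // ord_of_eq.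
- rewrite [LHS]/cycle_sl big_seq [RHS]big_seq; apply: eq_bigr => r.
  rewrite mem_rev mem_index_iota => rn.
  by rewrite weyl_elem ?mem_index_iota //; lia.
Qed.

End CycleMatrix.

(** * The presentation *)

Section TauSystem.
Variables (G : groupType) (N : nat) (a b : G).
Local Notation n := N.+3.
Local Open Scope group_scope.

Definition tau_ord (i j : 'I_n) : G := tau n a b i.+1 j.+1.

Hypothesis rel : presentation_relations n a b.

Lemma tau_steinberg : steinberg_system tau_ord.
Proof.
split.
- move=> i j k l ij kl il jk; apply/commgP/eqP/(tau_comm rel) => //; exact: mem_indices.
- by move=> i j k ij jk ik; apply: (tau_commutator rel); rewrite ?mem_indices.
- exact: steinberg_third (@elementary_steinberg n isT).
Qed.

Lemma tau_w_order4 i j : i != j -> weyl_elt tau_ord i j ^+ 4 = 1.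
Proof.
apply: (weyl_elt_order4 tau_steinberg (i0 := ord0) (j0 := lift ord0 ord0)) => //.
exact: (weyl_order4 rel).
Qed.

Lemma generators_subsystem :
  generated_by (subsystem tau_ord [set: 'I_n]) a /\
  generated_by (subsystem tau_ord [set: 'I_n]) b.
Proof.
split; last first.
  have -> : b = tau_ord (lift ord0 ord0) ord0.
    by rewrite /tau_ord /tau /= /conj_pow expg0 invg1 mul1g mulg1.
  by apply: generated_gen; exists (lift ord0 ord0), ord0; rewrite !inE.
rewrite [X in generated_by _ X](prod_weyl rel) big_seq.
elim/big_ind: _ => [|g h|r]; [exact: generated1|exact: generatedM|].
rewrite mem_rev mem_index_iota => rn.
have -> : weyl n a b r r.+1 = weyl_elt tau_ord (ord_of N r) (ord_of N r.+1).
  rewrite /weyl /weyl_elt /tau_ord !ord_of_val ?mem_index_iota; try lia.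
  by rewrite prednK //; lia.
apply: subsystemw; rewrite ?inE //.
by rewrite ord_of_eq ?mem_index_iota; lia.
Qed.

End TauSystem.

Theorem theorem2p10 (n : nat) (hn : (3 <= n)%N) :
  exists f : {multiplicative presented (relators n fg_a fg_b) ->
                             specialLinear int n},
    [/\ bijective f,
        slval (f (pr_class _ fg_a)) = a_mx n &
        slval (f (pr_class _ fg_b)) = b_mx n].
Proof.
case: n hn => [|[|[|N]]] // _; set n := N.+3; set R := relators n fg_a fg_b.
pose phi := free_lift (fun y : 'I_2 => if y == ord0 then cycle_sl N else elem N 2 1).
have phi_a : phi fg_a = cycle_sl N by rewrite /phi free_lift_gen.
have phi_b : phi fg_b = elem N 2 1 by rewrite /phi free_lift_gen.
have phiR r : r \in R -> phi r = 1%g.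
  move=> rR; have [_] := relatorsP n (cycle_sl N) (elem N 2 1); apply.
    exact: sl_relations.
  by rewrite -phi_a -phi_b -relators_morph map_f.
pose f : monoid.UMagmaMorphism.type (presented R) (specialLinear int n) :=
  presented_lift phiR.
have f_a : f (pr_class R fg_a) = cycle_sl N.
  by rewrite -phi_a; apply: presented_lift_class.
have f_b : f (pr_class R fg_b) = elem N 2 1.
  by rewrite -phi_b; apply: presented_lift_class.
have rel : presentation_relations n (pr_class R fg_a) (pr_class R fg_b).
  apply/relatorsP => r; rewrite -relators_morph => /mapP[r' r'R ->].
  exact: pr_class_rel.
have gen q : generated_by
    (subsystem (tau_ord (pr_class R fg_a) (pr_class R fg_b)) [set: 'I_n]) q.
  have [gen_a gen_b] := generators_subsystem rel.
  have gen_y y : generated_by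
      (subsystem (tau_ord (pr_class R fg_a) (pr_class R fg_b)) [set: 'I_n])
      (pr_class R (fgen y)).
    by case: y => -[|[|//]] lt2; [have -> : Ordinal lt2 = ord0 by exact: val_inj
      |have -> : Ordinal lt2 = ord_max by exact: val_inj].
  rewrite -[q]pr_classK.
  elim: (freeGroup_generated (repr q)) => [|g s _ IH [y ->]|g s _ IH [y ->]].
  - rewrite gmulf1; exact: generated1.
  - by rewrite gmulfM; apply: generatedM IH (gen_y y).
  - by rewrite gmulfM gmulfV; apply: generatedM IH (generatedV (gen_y y)).
have fx i j : i != j ->
    slval (f (tau_ord (pr_class R fg_a) (pr_class R fg_b) i j)) =
    (1%:M + delta_mx i j)%R.
  move=> ij; rewrite /tau_ord tau_morph f_a f_b tau_elem ?mem_indices //.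
  by rewrite /elem !ord_ofS elementaryE.
have inj_f : injective f.
  apply: gmulf_inj => q fq.
  exact: (subsystem_ker (tau_steinberg rel) (tau_w_order4 rel) fx (gen q) fq).
have surj_f A : exists q, f q == A.
  have [|q _ fq] := @supported_generated _ _ _ f fx [set: 'I_n] A.
    by move=> i j; rewrite !inE.
  by exists q; apply/eqP.
exists f; split; last 2 first.
- by rewrite f_a cycle_slE.
- by rewrite f_b elem_b.
exists (fun A => xchoose (surj_f A)) => [q|A]; last exact/eqP/(xchooseP (surj_f A)).
exact/inj_f/eqP/(xchooseP (surj_f (f q))).
Qed.
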